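(* Let $N\ge2$, $0<R_1<R_2$ and $\Omega=\{x\in\mathbb{R}^{N}\colon R_1<\|x\|<R_2\}$. Let $g\colon\mathbb{R}^{+}\to\mathbb{R}^{+}$ be a continuous function, regularly oscillating at zero, with $g(0)=0$ and $g(s)>0$ for $s>0$. Assume \[ \lim_{s\to0^{+}}\frac{g(s)}{s}=0\quad\text{and}\quad\lim_{s\to+\infty}\frac{g(s)}{s}=+\infty. \] Let $q(x)=\mathcal{Q}(\|x\|)$, $x\in\overline{\Omega}$, be a continuous radially symmetric function, with $\mathcal{Q}\colon[R_1,R_2]\to\mathbb{R}$ continuous, such that: (i) there exist $m\ge1$ closed and pairwise disjoint intervals $J_1,\dots,J_m\subseteq[R_1,R_2]$ for which, for $i=1,\dots,m$, $\mathcal{Q}(r)\ge0$ for every $r\in J_i$ with $\max_{r\in J_i}\mathcal{Q}(r)>0$, and $\mathcal{Q}(r)\le0$ for every $r\in[R_1,R_2]\setminus\bigcup_{i=1}^{m}J_i$; (ii) $\int_{\Omega}q(x)\,dx<0$. Then the Neumann problem \[ -\Delta u=q(x)\,g(u)\ \text{ in }\Omega,\qquad\frac{\partial u}{\partial\mathbf{n}}=0\ \text{ on }\partial\Omega, \] has at least one positive radially symmetric solution.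
   Context: $\mathbb{R}^{+}=[0,+\infty)$ and $\|\cdot\|$ is the Euclidean norm in $\mathbb{R}^N$. A positive radially symmetric solution is a classical solution $u$ such that $u(x)>0$ for all $x\in\Omega$ and $u(x')=u(x'')$ whenever $\|x'\|=\|x''\|$. The function $g$ is regularly oscillating at zero if $\lim_{s\to0^{+},\,\omega\to1}\frac{g(\omega s)}{g(s)}=1$ (joint limit). *)

(* Defs.v *)
From HB Require Import structures.
From mathcomp Require Import all_boot all_order all_algebra.
From mathcomp Require Import all_classical all_reals all_analysis.

Set Implicit Arguments.
Unset Strict Implicit.
Unset Printing Implicit Defensive.

Import Order.TTheory GRing.Theory Num.Theory.
Import numFieldNormedType.Exports.

Local Open Scope classical_set_scope.
Local Open Scope ring_scope.

(* Lebesgue measure on R^n, on the Borel sets of n.-tuple R, built by iterating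
   the binary product measure of the library. *)
Section lebesgue_cons.
Local Open Scope ereal_scope.
Context (R : realType) (n : nat).
Variable mu : {sigma_finite_measure set (n.-tuple (measurableTypeR R)) -> \bar R}.

Definition tuple_cons (p : measurableTypeR R * n.-tuple (measurableTypeR R)) :
  n.+1.-tuple (measurableTypeR R) := [tuple of p.1 :: p.2].

Lemma measurable_tuple_cons : measurable_fun [set: _] tuple_cons.
Proof. exact: measurable_cons. Qed.

Definition lebesgue_cons := pushforward (lebesgue_measure \x mu) tuple_cons.

Let lebesgue_cons0 : lebesgue_cons set0 = 0.
Proof. by rewrite /lebesgue_cons /pushforward preimage_set0 measure0. Qed.

Let lebesgue_cons_ge0 A : 0 <= lebesgue_cons A.
Proof. exact: (measure_ge0 (lebesgue_measure \x mu)). Qed.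

Let lebesgue_cons_sigma_additive : semi_sigma_additive lebesgue_cons.
Proof.
pose f := tuple_cons; have mf := measurable_tuple_cons.
move=> F mF tF mUF; rewrite /lebesgue_cons /pushforward preimage_bigcup.
apply: measure_semi_sigma_additive.
- by move=> k; rewrite -[X in measurable X]setTI; exact: mf.
- apply/trivIsetP => /= i j _ _ ij; rewrite -preimage_setI.
  by move/trivIsetP : tF => /(_ _ _ _ _ ij) ->//; rewrite preimage_set0.
- by rewrite -preimage_bigcup -[X in measurable X]setTI; exact: mf.
Qed.

HB.instance Definition _ := isMeasure.Build _ _ _ lebesgue_cons
  lebesgue_cons0 lebesgue_cons_ge0 lebesgue_cons_sigma_additive.

Let lebesgue_cons_sigma_finite : sigma_finite setT lebesgue_cons.
Proof.
pose g (t : n.+1.-tuple (measurableTypeR R)) := (thead t, [tuple of behead t]).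
have mg : measurable_fun setT g.
  apply: measurable_fun_pair; first exact: measurable_tnth.
  exact: measurable_behead.
have tupleK : cancel tuple_cons g.
  by case=> x t; rewrite /g theadE; congr pair; exact/val_inj.
have /sigma_finiteP[F [TF ndF Foo]] := sigma_finiteT (@lebesgue_measure R).
have /sigma_finiteP[G [TG ndG Goo]] := sigma_finiteT mu.
exists (fun k => g @^-1` (F k `*` G k)).
  rewrite -preimage_bigcup (_ : \bigcup_k _ = setT) ?preimage_setT//.
  rewrite -setXTT TF TG predeqE => -[x y]; split.
    by move=> [n0 _ []/= ? ?]; split; exists n0.
  move=> [/= [i _ Fix] [j _ Gjy]]; exists (maxn i j) => //; split.
    by move: x Fix; exact/subsetPset/ndF/leq_maxl.
  by move: y Gjy; exact/subsetPset/ndG/leq_maxr.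
move=> k; have [mF Fk] := Foo k; have [mG Gk] := Goo k.
split.
  by rewrite -[X in measurable X]setTI; apply: mg => //; exact: measurableX.
rewrite /lebesgue_cons /pushforward -comp_preimage.
rewrite (_ : g \o _ = id) ?preimage_id; last first.
  by apply/funext => x /=; rewrite tupleK.
by rewrite product_measure1E// lte_mul_pinfty// ge0_fin_numE.
Qed.

HB.instance Definition _ := Measure_isSigmaFinite.Build _ _ _ lebesgue_cons
  lebesgue_cons_sigma_finite.

End lebesgue_cons.

Fixpoint lebesgue_tuple (R : realType) (n : nat) :
    {sigma_finite_measure set (n.-tuple (measurableTypeR R)) -> \bar R} :=
  match n with
  | 0 => dirac ([tuple] : 0.-tuple (measurableTypeR R))
  | n'.+1 => lebesgue_cons (lebesgue_tuple R n')
  end.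

Lemma lebesgue_tuple_box (R : realType) (n : nat)
    (A : 'I_n -> set (measurableTypeR R)) :
  (forall i, measurable (A i)) ->
  lebesgue_tuple R n [set t | forall i, A i (tnth t i)] =
  (\prod_(i < n) lebesgue_measure (A i))%E.
Proof.
elim: n A => [|n IH] A mA.
  by rewrite big_ord0 /= diracE mem_set//; case.
rewrite big_ord_recl /= /lebesgue_cons /pushforward.
rewrite -(IH (fun i => A (lift ord0 i)))//.
rewrite -product_measure1E//.
  congr (product_measure1 _ _ _); apply/seteqP; split => [[x t]/= H|[x t]/= [H1 H2] i].
    by split=> [|i]; [exact: (H ord0)| have := H (lift ord0 i); rewrite tnthS].
  by case: (unliftP ord0 i) => [j|] ->; rewrite ?tnthS//; exact: H2.
rewrite (_ : [set t | _] = \bigcap_(i in [set: 'I_n])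
    ((@tnth n (measurableTypeR R))^~ i @^-1` A (lift ord0 i))).
  apply: fin_bigcap_measurable => // i _; rewrite -[X in measurable X]setTI.
  exact: measurable_tnth.
by apply/seteqP; split => [t H i _|t H i]; [exact: H|exact: (H i I)].
Qed.

Section euclidean_space.
Context (R : realType) (N : nat).
Implicit Types (x n : 'rV[R]_N) (Omega : set 'rV[R]_N) (u : 'rV[R]_N -> R).

Definition row_of_tuple (t : N.-tuple (measurableTypeR R)) : 'rV[R]_N :=
  \row_i tnth t i.

Definition lebesgue_integral_rV Omega (f : 'rV[R]_N -> R) : \bar R :=
  (\int[lebesgue_tuple R N]_(t in row_of_tuple @^-1` Omega)
     (f (row_of_tuple t))%:E)%E.

(* The norm `|x| of the library on 'rV[R]_N is the sup norm; it is used only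
   through the topology it induces. *)
Definition enorm x : R := Num.sqrt (\sum_(i < N) x 0 i ^+ 2).

Definition annulus (R1 R2 : R) : set 'rV[R]_N := [set x | R1 < enorm x < R2].

Definition radially_symmetric (A : set 'rV[R]_N) u : Prop :=
  forall x' x'', A x' -> A x'' -> enorm x' = enorm x'' -> u x' = u x''.

Definition basis_vec (i : 'I_N) : 'rV[R]_N := delta_mx 0 i.

Definition partial (i : 'I_N) u : 'rV[R]_N -> R := 'D_(basis_vec i) u.

Definition laplacian u x : R := \sum_(i < N) partial i (partial i u) x.

Definition C2_on Omega u : Prop :=
  [/\ forall x, Omega x -> {for x, continuous u},
      forall i x, Omega x ->
        derivable u x (basis_vec i) /\ {for x, continuous (partial i u)} &
      forall i j x, Omega x ->
        derivable (partial i u) x (basis_vec j) /\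
        {for x, continuous (partial j (partial i u))}].

(* u is continuous on the closure of the open set Omega and its first partial
   derivatives in Omega extend continuously to the closure. *)
Definition C1_closure Omega u : Prop :=
  {within closure Omega, continuous u} /\
  forall i, (forall x, Omega x -> derivable u x (basis_vec i)) /\
    exists2 G : 'rV[R]_N -> R,
      {within closure Omega, continuous G} &
      forall x, Omega x -> G x = partial i u x.

(* The quotient is one-sided because u only matters on the closure of Omega;
   n is the unit normal at x pointing outwards. *)
Definition is_normal_derivative u x n (l : R) : Prop :=
  (u x - u (x - t *: n)) / t @[t --> 0^'+] --> l.

Definition boundary Omega : set 'rV[R]_N := closure Omega `\` Omega^°.

Definition annulus_normal (R1 : R) x : 'rV[R]_N :=
  (if enorm x == R1 then - (enorm x)^-1 else (enorm x)^-1) *: x.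

Definition classical_neumann_solution (R1 R2 : R) (q : 'rV[R]_N -> R)
    (g : R -> R) u : Prop :=
  let Omega := annulus R1 R2 in
  [/\ C2_on Omega u,
      C1_closure Omega u,
      forall x, Omega x -> - laplacian u x = q x * g (u x) &
      forall x, boundary Omega x ->
        is_normal_derivative u x (annulus_normal R1 x) 0].

End euclidean_space.

Definition regularly_oscillating_at_zero (R : realType) (g : R -> R) : Prop :=
  g (p.2 * p.1) / g p.1 @[p --> filter_prod (0 : R)^'+ (nbhs (1 : R))] --> (1 : R).

(* Main.v *)
Require Import Defs.
From mathcomp Require Import all_boot all_order all_algebra.
From mathcomp Require Import all_classical all_reals all_analysis.
From mathcomp Require Import measurable_realfun.
From mathcomp Require Import ring lra.

(* Writing u(x) = W(|x|) and v = r^(N-1) W', the problem becomes the system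
   W' = v / r^(N-1), v' = - r^(N-1) Q(r) g(W) on [R1, R2] with v(R1) = v(R2) = 0.
   It is solved by shooting on the initial value s = W(R1), after replacing g by
   a continuous f, equal to g on [0, M], to 0 on the negative reals and linear
   beyond M.
   - For small s, regular oscillation makes f(W) nearly constant, so v(R2) has
     the sign of - int r^(N-1) Q, which is positive by (ii).
   - A positive solution with v(r0) = 0 satisfies W(r0) <= M: between r0 and the
     nearest J_i the solution does not decrease, and superlinearity bounds
     positive solutions on J_i (Sturm). Hence for s > M the solution vanishes
     somewhere, after which W stays nonpositive and v(R2) < 0.
   As g is only continuous, initial value problems need not have unique
   solutions; the intermediate value theorem is therefore applied to Euler
   polygons, which depend continuously on s, and solutions are obtained as
   pointwise limits of polygons along an ultrafilter. *)

Set Implicit Arguments.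
Unset Strict Implicit.
Unset Printing Implicit Defensive.

Import Order.TTheory GRing.Theory Num.Theory.
Import numFieldNormedType.Exports.

Local Open Scope classical_set_scope.
Local Open Scope ring_scope.

(** The shape of [f] serves both ends of the shooting. Its linear tail gives |f(s)| <= L|s| on the
    whole line, which keeps the polygons bounded and forbids a solution with positive initial value
    to reach W = v = 0; the value 0 on the negatives lets solutions that cross zero be followed up
    to R2. Beyond M the tail freezes f(s)/s at g(M)/M, so superlinearity survives the truncation
    from cM on; the constants of the bound on each J_i depend neither on M nor on f, and M is chosen
    after them. The truncation disappears at the end because a maximum of W is a point with v = 0:
    at R1 and R2 by the boundary conditions, inside because W' = 0 there. Condition (ii) is a
    Lebesgue integral over a subset of R^N. It is brought to the form int r^(N-1) Q < 0 without a
    change of variables: scaling gives the measure of balls up to a constant, hence that of shells,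
    and the integral over R1 < |x| < y is differentiated in y. *)

(** By compactness of [-B, B] the image ultrafilter has a cluster point, and an ultrafilter
    converges to its cluster points. This replaces the extraction of subsequences: one [G] serves
    all points r at once. *)
Lemma ultra_cvg_bounded (R : realType) (I : Type) (G : set_system I)
    (x : I -> R) (B : R) : UltraFilter G -> (forall n, `|x n| <= B) ->
  exists l : R, x n @[n --> G] --> l.
Proof.
move=> GU xB.
have [|l [_ clus]] := @segment_compact R (- B) B (x @ G) _.
  rewrite /= (_ : x @^-1` _ = setT); first exact: filterT.
  by apply/seteqP; split=> n //= _; rewrite in_itv/= -ler_norml.
exists l => V Vl /=; have [//|nV] := in_ultra_setVsetC (x @^-1` V) GU.
by have [y [/= ? ?]] := clus (~` V) V nV Vl.
Qed.

(** The division-free form of differentiability; the estimates below bound increments, not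
    quotients. *)
Lemma is_derive1_eps (R : realType) (w : R -> R) (r c : R) :
  (forall e, 0 < e -> exists2 d, 0 < d &
     forall x, `|x - r| < d -> `|w x - w r - (x - r) * c| <= e * `|x - r|) ->
  is_derive r 1 w c.
Proof.
move=> H.
suff cv : h^-1 *: ((w \o shift r) (h *: 1) - w r) @[h --> 0^'] --> c.
  by split; [apply/cvg_ex; exists c|exact: cvg_lim].
apply/cvgrPdist_le => e e0; have [d d0 Hd] := H _ e0.
near=> h.
have h0 : h != 0 by near: h; exact: nbhs_dnbhs_neq.
have hd : `|h| < d.
  by near: h; exact: dnbhs0_lt.
rewrite /= /GRing.scale/= mulr1.
have := Hd (h + r); rewrite addrK => /(_ hd) H'.
rewrite distrC -(ler_pM2r (_ : 0 < `|h|)) ?normr_gt0// -normrM.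
apply: le_trans H'; rewrite le_eqVlt; apply/orP; left; apply/eqP; congr (`|_|).
by field.
Unshelve. all: by end_near. Qed.

Lemma is_derive1_scale (R : realType) (c t : R) : is_derive t 1 (fun s => c * s) c.
Proof.
rewrite -[X in is_derive _ _ _ X]mulr1.
exact: (@is_deriveZ _ _ _ id c t 1 1 (is_derive_id _ _)).
Qed.

(** * Euler polygons and their limits *)

Section clamp.
Context (R : realType).
Implicit Types x y r : R.

(** Composition with [clamp] extends data on a segment by constants, so that continuity and bounds
    hold on the whole line. *)
Definition clamp x y r : R := Num.max x (Num.min r y).

Lemma clampP x y r : x <= y ->
  [\/ r <= x /\ clamp x y r = x, y <= r /\ clamp x y r = y |
      x <= r <= y /\ clamp x y r = r].
Proof.
move=> xy; rewrite /clamp; have [ry|ry] := leP r y.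
  have [xr|xr] := leP x r; first by constructor 3.
  by constructor 1; split=> //; exact: ltW.
by rewrite max_r//; constructor 2; split=> //; exact: ltW.
Qed.

Lemma clamp_itv x y r : x <= y -> x <= clamp x y r <= y.
Proof. by move=> xy; case: (clampP r xy) => -[? ->]; lra. Qed.

Lemma clamp_id x y r : x <= r <= y -> clamp x y r = r.
Proof.
move=> /andP[xr ry]; rewrite /clamp min_l//; exact: max_r.
Qed.

Lemma clamp_lip x y r r' : x <= y -> `|clamp x y r - clamp x y r'| <= `|r - r'|.
Proof.
move=> xy; case: (clampP r xy) => -[? ->]; case: (clampP r' xy) => -[? ->];
  rewrite !ler_norml; apply/andP; split; case: (lerP 0 (r - r')) => h;
  rewrite ?(ger0_norm h) ?(ltr0_norm h); lra.
Qed.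

Lemma le_clamp x y : {homo clamp x y : r r' / r <= r'}.
Proof.
move=> r r' rr'; rewrite /clamp; apply: le_max2 => //; exact: le_min2.
Qed.

Lemma clamp_continuous x y : x <= y -> continuous (clamp x y).
Proof.
move=> xy r; apply/cvgrPdist_lt => e e0; near=> r'.
apply: (le_lt_trans (clamp_lip _ _ xy)).
by near: r'; exact: cvgr_dist_lt.
Unshelve. all: by end_near. Qed.

End clamp.

Section polygon.
Context (R : realType) (R1 R2 : R).
Hypothesis R12 : R1 < R2.

Definition mesh n : R := (R2 - R1) / n.+1%:R.

(** The index of the last node not beyond r. Polygons are read at this node, as step functions; the
    omitted interpolation vanishes with the mesh. *)
Definition mesh_idx n (r : R) : nat := Num.truncn ((clamp R1 R2 r - R1) / mesh n).

Lemma mesh_gt0 n : 0 < mesh n.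
Proof. by rewrite divr_gt0// subr_gt0. Qed.

Lemma meshK n : n.+1%:R * mesh n = R2 - R1.
Proof. by rewrite /mesh mulrC divfK// pnatr_eq0. Qed.

Lemma mesh_idx_itv n r :
  (mesh_idx n r)%:R * mesh n <= clamp R1 R2 r - R1
    < (mesh_idx n r)%:R * mesh n + mesh n.
Proof.
have h0 := mesh_gt0 n.
have c0 : 0 <= (clamp R1 R2 r - R1) / mesh n.
  by rewrite divr_ge0 ?(ltW h0)// subr_ge0; have /andP[] := clamp_itv r (ltW R12).
have /andP[] := truncn_itv c0; rewrite -/(mesh_idx n r).
by rewrite ler_pdivlMr// ltr_pdivrMr// -natr1 mulrDl mul1r => -> ->.
Qed.

Lemma mesh_idx_le n r r' : r <= r' -> (mesh_idx n r <= mesh_idx n r')%N.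
Proof.
move=> rr'; apply: le_truncn; rewrite ler_pM2r ?invr_gt0 ?mesh_gt0//.
by rewrite lerB// le_clamp.
Qed.

Lemma mesh_idx_max n r : (mesh_idx n r <= n.+1)%N.
Proof.
have /andP[h _] := mesh_idx_itv n r; have /andP[_ c] := clamp_itv r (ltW R12).
rewrite -(ler_nat R) -(ler_pM2r (mesh_gt0 n)) meshK; lra.
Qed.

Lemma mesh_idx1 n : mesh_idx n R1 = 0%N.
Proof. by rewrite /mesh_idx clamp_id ?lexx ?(ltW R12)// subrr mul0r truncn0. Qed.

Lemma mesh_idx2 n : mesh_idx n R2 = n.+1.
Proof.
rewrite /mesh_idx clamp_id ?lexx ?(ltW R12)// -(meshK n) mulfK ?natrK//.
by rewrite gt_eqF// mesh_gt0.
Qed.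

Lemma mesh_cvg0 : mesh n @[n --> \oo] --> (0 : R).
Proof.
rewrite -(mulr0 (R2 - R1)); apply: cvgMr.
exact: (@cvg_harmonic R).
Qed.

Section limit.
Variables (W D : nat -> nat -> R).
Hypothesis WS : forall n k, W n k.+1 = W n k + mesh n * D n k.

(** Telescoping: each step contributes [mesh n] times the deviation of the slope from [c]. *)
Lemma polygon_increment n (c e : R) (k k' : nat) : (k <= k')%N ->
  (forall j, (k <= j < k')%N -> `|D n j - c| <= e) ->
  `|W n k' - W n k - (k'%:R - k%:R) * mesh n * c| <= e * ((k'%:R - k%:R) * mesh n).
Proof.
move=> /subnK <-; elim: (k' - k)%N => [|d IH] Dc.
  by rewrite add0n !subrr !mul0r subr0 normr0 mulr0.
have /IH{}IH : forall j, (k <= j < d + k)%N -> `|D n j - c| <= e.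
  by move=> j /andP[kj jd]; apply: Dc; rewrite kj ltnW//= addSn ltnS.
have Dj : `|D n (d + k)%N - c| <= e by apply: Dc; rewrite leq_addl addSn ltnS leqnn.
rewrite addSn WS -natr1.
rewrite (_ : _ - _ = (W n (d + k) - W n k - ((d + k)%:R - k%:R) * mesh n * c)
    + mesh n * (D n (d + k)%N - c)); last by ring.
apply: (le_trans (ler_normD _ _)).
rewrite (_ : e * _ = e * (((d + k)%:R - k%:R) * mesh n) + mesh n * e); last by ring.
rewrite lerD// normrM gtr0_norm ?mesh_gt0// ler_pM2l// mesh_gt0//.
Qed.

Context (G : set_system nat) {GP : ProperFilter G}.
Variable w : R -> R.
Hypotheses (Goo : \oo `<=` G).
Hypothesis Ww : forall r, W n (mesh_idx n r) @[n --> G] --> w r.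

Let meshG : mesh n @[n --> G] --> (0 : R).
Proof. by move=> A /mesh_cvg0/Goo. Qed.

(* The error from rounding the endpoints to the mesh disappears in the limit. *)
Lemma limit_increment (c e : R) r r' : r <= r' ->
  (\forall n \near G, forall j,
     (mesh_idx n r <= j < mesh_idx n r')%N -> `|D n j - c| <= e) ->
  `|w r' - w r - (clamp R1 R2 r' - clamp R1 R2 r) * c|
    <= e * (clamp R1 R2 r' - clamp R1 R2 r).
Proof.
move=> rr' H; set d := _ - clamp _ _ r.
have cl : `|W n (mesh_idx n r') - W n (mesh_idx n r) - d * c| @[n --> G] -->
    `|w r' - w r - d * c|.
  by apply: cvg_norm; apply: cvgB; [apply: cvgB; exact: Ww|exact: cvg_cst].
have cr : e * d + mesh n * (`|e| + `|c|) @[n --> G] --> e * d.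
  rewrite -[X in _ --> X](_ : e * d + 0 * (`|e| + `|c|) = _); last by rewrite mul0r addr0.
  by apply: cvgD; [exact: cvg_cst|exact: cvgMl].
apply: (ler_cvg_to cl cr); apply: filterS H => n Hn.
have := polygon_increment (mesh_idx_le n rr') Hn.
set k := mesh_idx n r; set k' := mesh_idx n r'.
have := mesh_idx_itv n r; have := mesh_idx_itv n r'; rewrite -/k -/k'.
move=> /andP[a1 a2] /andP[b1 b2].
set t := (k'%:R - k%:R) * mesh n; move=> tW.
have td : `|t - d| <= mesh n by rewrite ler_norml /t /d mulrBl; lra.
rewrite (_ : _ - d * c = W n k' - W n k - t * c + (t - d) * c); last by ring.
apply: (le_trans (ler_normD _ _)).
have -> : e * d + mesh n * (`|e| + `|c|) = (e * d + mesh n * `|e|) + mesh n * `|c|.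
  by ring.
rewrite lerD//; last by rewrite normrM ler_wpM2r.
apply: (le_trans tW).
rewrite -lerBlDl -mulrBr; apply: (le_trans (ler_norm _)).
by rewrite normrM mulrC ler_wpM2r.
Qed.

(** The case c = 0 of [limit_increment]. Only slopes of index below n.+1 enter, since the last node
    is R2. *)
Lemma limit_lipschitz B r r' : (forall n k, (k < n.+1)%N -> `|D n k| <= B) ->
  `|w r' - w r| <= B * `|clamp R1 R2 r' - clamp R1 R2 r|.
Proof.
move=> DB; wlog rr' : r r' / r <= r'.
  by move=> H; have [/H//|/ltW/H] := leP r r'; rewrite distrC [X in _ <= _ * X]distrC.
rewrite [X in _ <= _ * X]ger0_norm ?subr_ge0 ?le_clamp//.
have := @limit_increment 0 B r r' rr'; rewrite mulr0 subr0; apply.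
apply: nearW => n j /andP[_ jr']; rewrite subr0 DB//.
exact: (leq_trans jr' (mesh_idx_max _ _)).
Qed.

(** If the slopes at all nodes near r are eventually within e of [c], then so are the mean slopes
    between points near r, and this passes to the limit. *)
Lemma limit_is_derive c r : r \in `]R1, R2[ ->
  (forall e, 0 < e -> exists2 d, 0 < d & \forall n \near G, forall j,
     (j <= n.+1)%N -> `|R1 + j%:R * mesh n - r| < d -> `|D n j - c| <= e) ->
  is_derive r 1 w c.
Proof.
rewrite in_itv/= => /andP[r1 r2] H; apply: is_derive1_eps => e e0.
have [d d0 Hd] := H _ e0.
(* One half of [d] is for the distance to r, the other for rounding to nodes; the remaining terms
   keep x in [R1, R2], where [clamp] is the identity. *)
exists (Num.min (d / 2) (Num.min (r - R1) (R2 - r))).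
  by rewrite !lt_min divr_gt0// !subr_gt0 r1 r2.
have md : \forall n \near G, mesh n < d / 2.
  have d2 : 0 < d / 2 by rewrite divr_gt0.
  have /cvgrPdist_lt/(_ _ d2) := meshG; apply: filterS => n.
  by rewrite sub0r normrN gtr0_norm// mesh_gt0.
have key lo hi : lo <= hi -> R1 <= lo -> hi <= R2 -> r - d / 2 <= lo -> hi <= r + d / 2 ->
    `|w hi - w lo - (hi - lo) * c| <= e * (hi - lo).
  move=> lh l1 h2 ld hd; have := @limit_increment c e lo hi lh.
  rewrite (@clamp_id _ R1 R2 lo) ?(@clamp_id _ R1 R2 hi); last 2 first.
    - by rewrite h2 (le_trans l1).
    - by rewrite l1 (le_trans lh).
  apply; near=> n => j /andP[jl jh].
  have /andP[_ a2] := mesh_idx_itv n lo; have /andP[b1 _] := mesh_idx_itv n hi.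
  move: a2 b1; rewrite !clamp_id ?h2 ?l1 ?(le_trans l1)//; last first.
    by rewrite (le_trans lh).
  move=> a2 b1.
  have mn : mesh n < d / 2 by near: n.
  have m0 := mesh_gt0 n.
  apply: (near Hd n) => //; first exact: (leq_trans (ltnW jh) (mesh_idx_max _ _)).
  have : (mesh_idx n lo)%:R * mesh n <= j%:R * mesh n by rewrite ler_pM2r// ler_nat.
  have : j%:R * mesh n <= (mesh_idx n hi)%:R * mesh n.
    by rewrite ler_pM2r// ler_nat ltnW.
  by rewrite ltr_norml; lra.
move=> x; rewrite !lt_min => /and3P[x1 x2 x3].
have [xr|/ltW xr] := leP r x.
  move: x1 x2 x3; rewrite ger0_norm ?subr_ge0// => x1 x2 x3; apply: key; lra.
move: x1 x2 x3; rewrite -normrN opprB ger0_norm ?subr_ge0// => x1 x2 x3.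
rewrite -normrN (_ : - (_ - _) = w r - w x - (r - x) * c); last by ring.
by apply: key; lra.
Unshelve. all: by end_near. Qed.

End limit.
End polygon.

(** * Euler polygons of a planar system, their limits, and shooting *)

Section euler.
Context (R : realType) (R1 R2 : R) (F1 F2 : R -> R -> R -> R) (C : R).
Hypothesis R12 : R1 < R2.
Hypothesis F1c : continuous (fun z : R * (R * R) => F1 z.1 z.2.1 z.2.2).
Hypothesis F2c : continuous (fun z : R * (R * R) => F2 z.1 z.2.1 z.2.2).
Hypothesis C0 : 0 <= C.
Hypothesis F1C : forall t x y, `|F1 t x y| <= C * (`|x| + `|y|).
Hypothesis F2C : forall t x y, `|F2 t x y| <= C * (`|x| + `|y|).

(* Solutions are extended by constants outside [R1, R2]. *)
Definition ode_sol (u v : R -> R) : Prop :=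
  [/\ continuous u, continuous v,
      forall r, u (clamp R1 R2 r) = u r, forall r, v (clamp R1 R2 r) = v r &
      forall r, r \in `]R1, R2[ ->
        is_derive r 1 u (F1 r (u r) (v r)) /\ is_derive r 1 v (F2 r (u r) (v r))].

Let h := mesh R1 R2.
Let h_gt0 n : 0 < h n := mesh_gt0 R12 n.

(** The second component starts at 0, the Neumann condition at R1; [s] is the shooting parameter. *)
Fixpoint euler n (s : R) k : R * R :=
  if k is k'.+1 then
    let: (x, y) := euler n s k' in
    let t := R1 + k'%:R * h n in (x + h n * F1 t x y, y + h n * F2 t x y)
  else (s, 0).

Let U n s k := (euler n s k).1.
Let V n s k := (euler n s k).2.
Let D1 n s k := F1 (R1 + k%:R * h n) (U n s k) (V n s k).
Let D2 n s k := F2 (R1 + k%:R * h n) (U n s k) (V n s k).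

Let US n s k : U n s k.+1 = U n s k + h n * D1 n s k.
Proof. by rewrite /D1 /U /V /=; case: euler. Qed.

Let VS n s k : V n s k.+1 = V n s k + h n * D2 n s k.
Proof. by rewrite /D2 /U /V /=; case: euler. Qed.

(** Discrete Gronwall inequality: a step multiplies |x| + |y| by at most 1 + 2Ch <= exp(2Ch), and k
    steps have total length kh <= R2 - R1. *)
Lemma euler_bound n s k : (k <= n.+1)%N ->
  `|U n s k| + `|V n s k| <= `|s| * expR (2 * C * (R2 - R1)).
Proof.
move=> kn.
have step : `|U n s k| + `|V n s k| <= `|s| * expR (2 * C * h n) ^+ k.
  elim: k {kn} => [|k IH]; first by rewrite expr0 mulr1 /U/= normr0 addr0.
  rewrite US VS exprSr mulrA.
  set x := U n s k in IH *; set y := V n s k in IH *.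
  apply: (@le_trans _ _ ((`|x| + `|y|) * (1 + 2 * C * h n))).
    rewrite (_ : _ * _ = (`|x| + h n * (C * (`|x| + `|y|))) +
                         (`|y| + h n * (C * (`|x| + `|y|)))); last by ring.
    have hF z d : `|d| <= C * (`|x| + `|y|) ->
        `|z + h n * d| <= `|z| + h n * (C * (`|x| + `|y|)).
      move=> dC; apply: (le_trans (ler_normD _ _)).
      by rewrite lerD2l normrM (gtr0_norm (h_gt0 n)) ler_wpM2l// ltW.
    by apply: lerD; apply: hF; [exact: F1C|exact: F2C].
  apply: ler_pM => //.
  - by apply: addr_ge0; [|apply: mulr_ge0; [exact: mulr_ge0|exact/ltW/h_gt0]].
  - exact: expR_ge1Dx.
apply: (le_trans step); rewrite ler_wpM2l// -expRM_natl ler_expR.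
rewrite mulrCA -(meshK R1 R2 n); apply: ler_wpM2l; first exact: mulr_ge0.
by rewrite ler_pM2r ?h_gt0// ler_nat.
Qed.

Lemma euler_continuous n k :
  continuous (fun s => (euler n s k).1) /\ continuous (fun s => (euler n s k).2).
Proof.
elim: k => [|k [IH1 IH2]]; first by split=> s; [exact: cvg_id|exact: cvg_cst].
have pc s : (R1 + k%:R * h n, (U n x k, V n x k)) @[x --> s] -->
    (R1 + k%:R * h n, (U n s k, V n s k)).
  exact: (cvg_pair (@cvg_cst _ _ _ _ _) (cvg_pair (IH1 s) (IH2 s))).
split=> s.
- rewrite (_ : (fun x => _) = fun x => U n x k + h n * D1 n x k); last first.
    by apply/funext => x; exact: US.
  apply: cvgD; first exact: IH1.
  apply: cvgMr; exact: (cvg_comp _ _ (pc s) (@F1c _)).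
- rewrite (_ : (fun x => _) = fun x => V n x k + h n * D2 n x k); last first.
    by apply/funext => x; exact: VS.
  apply: cvgD; first exact: IH2.
  apply: cvgMr; exact: (cvg_comp _ _ (pc s) (@F2c _)).
Qed.

(** The common Lipschitz constant [B] turns convergence at the single point r into control of all
    nodes near r: such a node and the node used at r are less than d/(2B) apart, which costs d/2,
    and the convergence at r costs the other d/2. *)
Lemma polygon_near (W D : nat -> nat -> R) (B x d r : R) (G : set_system nat) :
  ProperFilter G -> \oo `<=` G ->
  (forall n k, W n k.+1 = W n k + mesh R1 R2 n * D n k) ->
  0 < B -> 0 < d -> R1 <= r <= R2 ->
  (forall n k, (k < n.+1)%N -> `|D n k| <= B) ->
  W n (mesh_idx R1 R2 n r) @[n --> G] --> x ->
  \forall n \near G, forall j, (j <= n.+1)%N ->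
    `|R1 + j%:R * mesh R1 R2 n - r| < d / (4 * B) -> `|W n j - x| < d.
Proof.
move=> GP Goo WS B0 d0 rI DB Wx.
have meshG : mesh R1 R2 n @[n --> G] --> (0 : R).
  by move=> A mA; apply: Goo; exact: mesh_cvg0.
have d2 : 0 < d / 2 by rewrite divr_gt0.
have d4 : 0 < d / (4 * B) by rewrite !(divr_gt0,mulr_gt0).
near=> n => j jn jr.
have m0 := mesh_gt0 R12 n.
have hm : mesh R1 R2 n < d / (4 * B).
  rewrite -[X in X < _]gtr0_norm// -normrN -sub0r; near: n.
  by move/cvgrPdist_lt : meshG; exact.
have hx : `|W n (mesh_idx R1 R2 n r) - x| < d / 2.
  by rewrite distrC; near: n; move/cvgrPdist_lt : Wx; exact.
set k := mesh_idx R1 R2 n r in hx.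
have kn : (k <= n.+1)%N := mesh_idx_max R12 n r.
have /andP[k1 k2] := mesh_idx_itv R12 n r.
rewrite clamp_id// -/k in k1 k2.
have jk : `|W n j - W n k| <= B * `|(j%:R - k%:R) * mesh R1 R2 n|.
  have [kj|/ltnW kj] := leqP k j.
    have /= := @polygon_increment _ _ _ R12 _ _ WS n 0 B k j kj.
    rewrite mulr0 subr0 [X in _ -> _ <= _ * X]ger0_norm; last first.
      by rewrite mulr_ge0 ?(ltW m0)// subr_ge0 ler_nat.
    apply=> i /andP[_ ij]; rewrite subr0 DB//; exact: leq_trans ij jn.
  have /= := @polygon_increment _ _ _ R12 _ _ WS n 0 B j k kj.
  rewrite mulr0 subr0 distrC -[`|(j%:R - _) * _|]normrN -mulNr opprB.
  rewrite [X in _ -> _ <= _ * X]ger0_norm; last first.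
    by rewrite mulr_ge0 ?(ltW m0)// subr_ge0 ler_nat.
  apply=> i /andP[_ ij]; rewrite subr0 DB//; exact: leq_trans ij kn.
have : `|(j%:R - k%:R) * mesh R1 R2 n| < d / (2 * B).
  have -> : d / (2 * B) = d / (4 * B) + d / (4 * B) by field; rewrite gt_eqF.
  by move: jr; rewrite mulrBl !ltr_norml; lra.
rewrite -(ltr_pM2l B0) (_ : B * (d / (2 * B)) = d / 2); last first.
  by field; rewrite gt_eqF.
move=> jk2; rewrite (_ : _ - x = (W n j - W n k) + (W n k - x)); last by ring.
apply: (le_lt_trans (ler_normD _ _)); lra.
Unshelve. all: by end_near. Qed.

(** The initial value may vary with n, because in the shooting it is a zero found separately for
    each polygon. The limits are Lipschitz, and continuity of the right-hand sides makes the slopes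
    near r converge to the field at the limit point. *)
Lemma euler_limit (s : nat -> R) (S : R) (G : set_system nat) :
  UltraFilter G -> \oo `<=` G -> (forall n, `|s n| <= S) ->
  exists u v : R -> R, [/\ ode_sol u v, s n @[n --> G] --> u R1, v R1 = 0 &
    (euler n (s n) n.+1).2 @[n --> G] --> v R2].
Proof.
move=> GU Goo sS.
have GP : ProperFilter G := @ultra_proper _ _ GU.
pose K := S * expR (2 * C * (R2 - R1)).
have S0 : 0 <= S by apply: le_trans (sS 0%N).
have K0 : 0 <= K by rewrite mulr_ge0// expR_ge0.
have UVK n k : (k <= n.+1)%N -> `|U n (s n) k| + `|V n (s n) k| <= K.
  move=> kn; apply: (le_trans (euler_bound _ kn)).
  by rewrite /K ler_wpM2r// expR_ge0.
(* C K already bounds the slopes; adding 1 allows division by [B]. *)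
pose B := C * K + 1.
have B0 : 0 < B by rewrite ltr_wpDl// mulr_ge0.
have D1B n k : (k < n.+1)%N -> `|D1 n (s n) k| <= B.
  move=> kn; apply: (le_trans (F1C _ _ _)); rewrite ler_wpDr//.
  by rewrite ler_wpM2l//; apply: UVK; exact: ltnW.
have D2B n k : (k < n.+1)%N -> `|D2 n (s n) k| <= B.
  move=> kn; apply: (le_trans (F2C _ _ _)); rewrite ler_wpDr//.
  by rewrite ler_wpM2l//; apply: UVK; exact: ltnW.
have /choice[u uP] : forall r, exists l : R, U n (s n) (mesh_idx R1 R2 n r) @[n --> G] --> l.
  move=> r; apply: (@ultra_cvg_bounded _ _ _ _ K) => n.
  by have := UVK n _ (mesh_idx_max R12 n r); apply: le_trans; rewrite lerDl.
have /choice[v vP] : forall r, exists l : R, V n (s n) (mesh_idx R1 R2 n r) @[n --> G] --> l.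
  move=> r; apply: (@ultra_cvg_bounded _ _ _ _ K) => n.
  by have := UVK n _ (mesh_idx_max R12 n r); apply: le_trans; rewrite lerDr.
have R1I : R1 <= R1 <= R2 by rewrite lexx ltW.
have ulip r r' : `|u r' - u r| <= B * `|clamp R1 R2 r' - clamp R1 R2 r|.
  exact: (limit_lipschitz R12 (fun n k => US n (s n) k) Goo uP _ _ D1B).
have vlip r r' : `|v r' - v r| <= B * `|clamp R1 R2 r' - clamp R1 R2 r|.
  exact: (limit_lipschitz R12 (fun n k => VS n (s n) k) Goo vP _ _ D2B).
have lipc (w : R -> R) : (forall r r', `|w r' - w r| <= B * `|clamp R1 R2 r' - clamp R1 R2 r|) ->
    continuous w /\ forall r, w (clamp R1 R2 r) = w r.
  move=> wl; split=> [r|r].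
    apply/cvgrPdist_lt => e e0; have eB : 0 < e / B by rewrite divr_gt0.
    near=> r'; apply: (le_lt_trans (wl _ _)).
    rewrite mulrC -ltr_pdivlMr//; apply: (le_lt_trans (clamp_lip _ _ (ltW R12))).
    by near: r'; exact: cvgr_dist_lt.
  apply/eqP; rewrite -subr_eq0 -normr_le0; apply: (le_trans (wl _ _)).
  rewrite (@clamp_id _ R1 R2 (clamp _ _ _)) ?subrr ?normr0 ?mulr0//.
  exact: clamp_itv (ltW R12).
have [uc ucl] := lipc _ ulip; have [vc vcl] := lipc _ vlip.
have uv_near r d : 0 < d -> R1 <= r <= R2 ->
    \forall n \near G, forall j, (j <= n.+1)%N ->
    `|R1 + j%:R * h n - r| < d / (4 * B) ->
    `|U n (s n) j - u r| < d /\ `|V n (s n) j - v r| < d.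
  move=> d0 rI.
  have H1 := polygon_near GP Goo (fun n k => US n (s n) k) B0 d0 rI D1B (uP r).
  have H2 := polygon_near GP Goo (fun n k => VS n (s n) k) B0 d0 rI D2B (vP r).
  by apply: filterS2 H1 H2 => n n1 n2 j jn jr; split; [exact: n1|exact: n2].
have slope (F : R -> R -> R -> R) r :
    continuous (fun z : R * (R * R) => F z.1 z.2.1 z.2.2) -> R1 <= r <= R2 ->
    forall e, 0 < e -> exists2 d, 0 < d & \forall n \near G, forall j,
     (j <= n.+1)%N -> `|R1 + j%:R * mesh R1 R2 n - r| < d ->
     `|F (R1 + j%:R * h n) (U n (s n) j) (V n (s n) j) - F r (u r) (v r)| <= e.
  move=> Fc rI e e0.
  have /cvgrPdist_le/(_ _ e0) := Fc (r, (u r, v r)).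
  rewrite -nbhs_ballE => -[d /= d0 dF].
  exists (Num.min d (d / (4 * B))); first by rewrite lt_min d0 divr_gt0// mulr_gt0.
  have := uv_near r d d0 rI; apply: filterS => n Hn j jn.
  rewrite lt_min => /andP[jd /(Hn _ jn)[ju jv]].
  rewrite distrC; apply: (dF (_, (_, _))).
  by split => /=; [|split => /=]; rewrite -ball_normE/= distrC.
exists u, v; split.
- split=> // r rI; have rI' : R1 <= r <= R2.
    by move: rI; rewrite in_itv/= => /andP[? ?]; rewrite !ltW.
  split.
    apply: (limit_is_derive R12 (fun n k => US n (s n) k) Goo uP) => //.
    exact: slope.
  apply: (limit_is_derive R12 (fun n k => VS n (s n) k) Goo vP) => //.
  exact: slope.
- have := uP R1; rewrite (_ : (fun n => _) = s)//.
  by apply/funext => n; rewrite mesh_idx1.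
- have := vP R1; rewrite (_ : (fun n => _) = cst 0); last first.
    by apply/funext => n; rewrite mesh_idx1.
  by move=> vR1; exact: (cvg_unique _ vR1 (@cvg_cst _ _ _ _ _)).
- have := vP R2; rewrite (_ : (fun n => _) = fun n => (euler n (s n) n.+1).2)//.
  by apply/funext => n; rewrite mesh_idx2.
Unshelve. all: by end_near. Qed.

(** The sign hypotheses concern every solution with the given data, since it is not known which one
    the polygons approach. Being strict, the sign of the limit is shared by the polygons for
    [G]-almost all n; each of these then has a zero between s0 and s1, and the limit along these
    zeros is the solution sought. *)
Lemma shooting (s0 s1 : R) : s0 <= s1 ->
  (forall u v, ode_sol u v -> u R1 = s0 -> v R1 = 0 -> 0 < v R2) ->
  (forall u v, ode_sol u v -> u R1 = s1 -> v R1 = 0 -> v R2 < 0) ->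
  exists u v, [/\ ode_sol u v, s0 <= u R1 <= s1, v R1 = 0 & v R2 = 0].
Proof.
move=> s01 H0 H1.
have [G [GU Goo]] := ultraFilterLemma (eventually_filter : ProperFilter \oo).
have GP : ProperFilter G := @ultra_proper _ _ GU.
pose end_ n s := (euler n s n.+1).2.
have e0 : \forall n \near G, 0 < end_ n s0.
  have [u [v [uv us v0]]] := euler_limit GU Goo (fun=> lexx `|s0|).
  move=> /cvgr_gt; apply; apply: (H0 u v) => //.
  exact: (cvg_unique _ us (@cvg_cst _ _ _ _ _)).
have e1 : \forall n \near G, end_ n s1 < 0.
  have [u [v [uv us v0]]] := euler_limit GU Goo (fun=> lexx `|s1|).
  move=> /cvgr_lt; apply; apply: (H1 u v) => //.
  exact: (cvg_unique _ us (@cvg_cst _ _ _ _ _)).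
(* Where the end signs are not yet right, [s0] serves as a default; such n are negligible for
   [G]. *)
have /choice[s sP] : forall n, exists s, s0 <= s <= s1 /\
    (0 < end_ n s0 -> end_ n s1 < 0 -> end_ n s = 0).
  move=> n; have [p0|_] := ltP 0 (end_ n s0); last by exists s0; rewrite lexx s01.
  have [p1|_] := ltP (end_ n s1) 0; last by exists s0; rewrite lexx s01.
  have [||s sI s_0] := @IVT _ (end_ n) s0 s1 0 s01.
  - by apply: continuous_subspaceT; have [] := euler_continuous n n.+1.
  - by rewrite ge_min le_max (ltW p0) (ltW p1) orbT.
  by exists s; split; [move: sI; rewrite in_itv|].
have sS n : `|s n| <= `|s0| + `|s1|.
  have [/andP[a b] _] := sP n; rewrite ler_norml.
  have := ler_norm s1; have := ler_norm (- s0); rewrite normrN.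
  have := normr_ge0 s0; have := normr_ge0 s1; lra.
have [u [v [uv us v0 vR2]]] := euler_limit GU Goo sS.
exists u, v; split=> //.
  apply/andP; split.
    by apply: (cvgr_to_ge us); apply: nearW => n; have [/andP[]] := sP n.
  by apply: (cvgr_to_le us); apply: nearW => n; have [/andP[]] := sP n.
have z : \forall n \near G, (euler n (s n) n.+1).2 = 0.
  by apply: filterS2 e0 e1 => n p0 p1; have [_] := sP n; exact.
have cz : (euler n (s n) n.+1).2 @[n --> G] --> (0 : R) by apply: cvg_near_cst.
exact: (cvg_unique _ vR2 cz).
Qed.

End euler.

(** * Lebesgue measure in polar coordinates *)

Definition scaled_pushforward d1 d2 (T1 : measurableType d1)
    (T2 : measurableType d2) (R : realType) (k : {nonneg R})
    (mu : {measure set T1 -> \bar R}) (f : T1 -> T2)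
    (mf : measurable_fun [set: T1] f) : {measure set T2 -> \bar R} :=
  mscale k (measure_function_pushforward__canonical__measure_function_Measure mu mf).

Section scaling.
Local Open Scope ereal_scope.
Context (R : realType).
Implicit Types (c : R) (n : nat).

Lemma measurable_scale c : measurable_fun [set: measurableTypeR R]
  (fun x : measurableTypeR R => (c * x)%R : measurableTypeR R).
Proof. exact: mulrl_measurable. Qed.

(** Both sides are measures in A that agree on half-open intervals, and these determine Lebesgue
    measure. *)
Lemma lebesgue_measure_scale c (A : set (measurableTypeR R)) : (0 < c)%R ->
  measurable A ->
  c%:E * lebesgue_measure ((fun x : measurableTypeR R => (c * x)%R) @^-1` A) =
    lebesgue_measure A.
Proof.
move=> c0 mA.
pose k : {nonneg R} := NngNum (ltW c0).
pose m := scaled_pushforward k lebesgue_measure (measurable_scale c).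
suff : forall X, ocitv X -> lebesgue_measure X = m X.
  by move=> /lebesgue_measure_unique/(_ A mA).
move=> _ [[a b] _ <-]; rewrite /m /= /mscale/= /pushforward.
rewrite (_ : _ @^-1` _ = `](a / c)%R, (b / c)%R]%classic); last first.
  apply/seteqP; split=> x /=; rewrite !in_itv/= ltr_pdivrMr// ler_pdivlMr//;
    by rewrite ![(x * c)%R]mulrC.
rewrite !lebesgue_measure_itv/= !lte_fin ltr_pM2r ?invr_gt0//.
case: ifP => _; last by rewrite mule0.
by rewrite -!EFinB -EFinM; congr EFin; field; rewrite gt_eqF.
Qed.

Definition tuple_scale c n (t : n.-tuple (measurableTypeR R)) :
  n.-tuple (measurableTypeR R) := [tuple (c * tnth t i)%R | i < n].

Lemma measurable_tuple_scale c n : measurable_fun setT (@tuple_scale c n).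
Proof.
apply/measurable_fun_tnthP => i.
rewrite (_ : _ \o _ = (fun x : measurableTypeR R => (c * x)%R : measurableTypeR R)
    \o (fun t : n.-tuple (measurableTypeR R) => tnth t i)); last first.
  by apply/funext => t /=; rewrite tnth_mktuple.
apply: measurableT_comp; first exact: measurable_scale.
exact: measurable_tnth.
Qed.

(** Induction on the dimension: the rescaled image of the product measure has the right values on
    rectangles, hence equals the product measure. *)
Lemma lebesgue_tuple_scale c n (A : set (n.-tuple (measurableTypeR R))) :
  (0 < c)%R -> measurable A ->
  (c ^+ n)%:E * lebesgue_tuple R n (@tuple_scale c n @^-1` A) =
    lebesgue_tuple R n A.
Proof.
move=> c0; elim: n A => [|n IH] A mA.
  rewrite expr0 mul1e /=; congr (dirac _ _).
  by apply/seteqP; split=> t /=; rewrite [tuple_scale _ _]tuple0 [t]tuple0.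
pose k : {nonneg R} := NngNum (exprn_ge0 n.+1 (ltW c0)).
pose sc (p : measurableTypeR R * n.-tuple (measurableTypeR R)) :
  measurableTypeR R * n.-tuple (measurableTypeR R) := ((c * p.1)%R, tuple_scale c p.2).
have msc : measurable_fun setT sc.
  apply: measurable_fun_pair.
    exact: (measurableT_comp (measurable_scale c) measurable_fst).
  exact: (measurableT_comp (@measurable_tuple_scale c n) measurable_snd).
have mA' : measurable (@tuple_cons R n @^-1` A).
  by rewrite -[X in measurable X]setTI; exact: measurable_tuple_cons.
pose m := scaled_pushforward k (lebesgue_measure \x lebesgue_tuple R n) msc.
have := @product_measure_unique _ _ _ _ _ lebesgue_measure (lebesgue_tuple R n) m _ _ mA'.
rewrite /= /lebesgue_cons /pushforward => ->; last first.
  move=> X Y mX mY; rewrite /m /= /mscale/= /pushforward.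
  rewrite (_ : sc @^-1` _ = ((fun x : measurableTypeR R => (c * x)%R) @^-1` X) `*`
    (@tuple_scale c n @^-1` Y)); last by [].
  rewrite product_measure1E//=; last 2 first.
  - by rewrite -[X in measurable X]setTI; exact: measurable_scale.
  - by rewrite -[X in measurable X]setTI; exact: measurable_tuple_scale.
  rewrite exprS EFinM muleACA.
  congr (_ * _); [exact: lebesgue_measure_scale|exact: IH].
rewrite /m /= /mscale/= /pushforward.
congr (_%:E * (lebesgue_measure \x lebesgue_tuple R n) _).
suff E p : tuple_cons (sc p) = tuple_scale c (tuple_cons p).
  by apply/seteqP; split=> p /=; rewrite E.
apply: eq_from_tnth => i; rewrite tnth_mktuple.
by case: (unliftP ord0 i) => [j|] ->; rewrite !(tnth0,tnthS)// tnth_mktuple.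
Qed.
End scaling.

Lemma is_derive1_epsE (R : realType) (w : R -> R) (r c e : R) :
  is_derive r 1 w c -> 0 < e -> exists2 d, 0 < d &
     forall x, `|x - r| < d -> `|w x - w r - (x - r) * c| <= e * `|x - r|.
Proof.
move=> [dw wc] e0.
have : h^-1 *: ((w \o shift r) (h *: 1) - w r) @[h --> 0^'] --> c.
  by rewrite -wc; exact: dw.
move=> /cvgrPdist_le/(_ _ e0) -[d /= d0 H]; exists d => // x xr.
have [->|xnr] := eqVneq x r; first by rewrite !subrr mul0r subrr normr0 mulr0.
have nz : x - r != 0 by rewrite subr_eq0.
have /(_ _ nz) := H (x - r); rewrite /ball_/= sub0r normrN => /(_ xr).
rewrite /GRing.scale/= mulr1 subrK -(ler_pM2r (_ : 0 < `|x - r|)) ?normr_gt0//.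
apply: le_trans; rewrite -normrM distrC le_eqVlt; apply/orP; left; apply/eqP.
by congr (`|_|); field.
Qed.

(** Chain rule for a function F with density q relative to H. Later F is an integral over shells and
    H the volume of a ball; increments of H are never divided by, so H may be locally constant. *)
Lemma is_derive1_relative (R : realType) (F H : R -> R) (r q h : R) :
  is_derive r 1 H h ->
  (forall e, 0 < e -> exists2 d, 0 < d & forall x, `|x - r| < d ->
     `|F x - F r - (H x - H r) * q| <= e * `|H x - H r|) ->
  is_derive r 1 F (h * q).
Proof.
move=> Hh FH; apply: is_derive1_eps => e e0.
have p1 : 0 < `|h| + 1 by rewrite ltr_wpDl.
have p2 : 0 < `|q| + 1 by rewrite ltr_wpDl.
(* [|h| + 1] is a Lipschitz bound for H at r, obtained from [D2]; the error e is split between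
   replacing F by H and replacing H by its linear part. *)
have [d1 d10 D1] := FH (e / 2 / (`|h| + 1)) ltac:(by rewrite !divr_gt0).
have [d2 d20 D2] := is_derive1_epsE Hh (ltr01 : (0 : R) < 1).
have [d3 d30 D3] := is_derive1_epsE Hh
  (ltac:(by rewrite !divr_gt0) : 0 < e / 2 / (`|q| + 1)).
exists (Num.min d1 (Num.min d2 d3)); first by rewrite !lt_min d10 d20.
move=> x; rewrite !lt_min => /and3P[/D1 {}D1 /D2 {}D2 /D3 {}D3].
have Hx : `|H x - H r| <= (`|h| + 1) * `|x - r|.
  rewrite (_ : H x - H r = (H x - H r - (x - r) * h) + (x - r) * h); last by ring.
  apply: (le_trans (ler_normD _ _)); rewrite normrM [`|x - r| * _]mulrC; lra.
rewrite (_ : F x - F r - (x - r) * (h * q) = (F x - F r - (H x - H r) * q)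
   + (H x - H r - (x - r) * h) * q); last by ring.
apply: (le_trans (ler_normD _ _)); rewrite (normrM _ q).
have A1 : e / 2 / (`|h| + 1) * `|H x - H r| <= e / 2 * `|x - r|.
  rewrite -!mulrA ler_pM2l// ler_pM2l ?invr_gt0// mulrC ler_pdivrMr// mulrC//.
have A2 : `|H x - H r - (x - r) * h| * `|q| <= e / 2 * `|x - r|.
  apply: (@le_trans _ _ (e / 2 / (`|q| + 1) * `|x - r| * (`|q| + 1))).
    by rewrite ler_pM// lerDl.
  by rewrite mulrAC divfK// gt_eqF.
lra.
Qed.

Lemma is_derive1_exprn (R : realType) n (x : R) :
  is_derive x 1 (fun y => y ^+ n) (n%:R * x ^+ n.-1).
Proof.
split; first exact: exprn_derivable.
by rewrite exp_derive /GRing.scale/= mulr1.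
Qed.

(** * Differentiation of integrals over spherical shells *)

Section radial_integral.
Context d (T : measurableType d) (R : realType) (mu : {measure set T -> \bar R}).
Variables (rho : T -> R) (V : R) (N : nat) (Q : R -> R) (K R1 R2 : R).
Hypothesis mrho : measurable_fun setT rho.
Hypothesis muV : forall r, 0 < r -> mu [set t | rho t < r] = (V * r ^+ N)%:E.
Hypotheses (R10 : 0 < R1) (R12 : R1 < R2).
Hypotheses (Qc : continuous Q) (QK : forall r, `|Q r| <= K).

Let f t := Q (rho t).

Let V0 : 0 <= V.
Proof.
have := muV (ltr01 : (0 : R) < 1).
by rewrite expr1n mulr1 => h; rewrite -lee_fin -h measure_ge0.
Qed.

Let mshell (I : interval R) : measurable [set t | rho t \in I].
Proof.
rewrite (_ : [set t | _] = rho @^-1` [set` I]); last by [].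
by rewrite -[X in measurable X]setTI; exact: mrho.
Qed.

(** The measure is known for open balls only; their differences are the shells closed inside and
    open outside, whence the half-open intervals. *)
Let mu_shell (x y : R) : 0 < x -> x <= y ->
  mu [set t | rho t \in `[x, y[] = (V * (y ^+ N - x ^+ N))%:E.
Proof.
move=> x0 xy; have y0 := lt_le_trans x0 xy.
rewrite (_ : [set t | _] = [set t | rho t < y] `\` [set t | rho t < x]); last first.
  apply/seteqP; split=> t /=; rewrite in_itv/=.
    by move=> /andP[xr ry]; split=> //; apply/negP; rewrite -leNgt.
  by move=> [ry /negP]; rewrite -leNgt ry andbT.
have mlt z : measurable [set t | rho t < z].
  rewrite (_ : [set t | _] = [set t | rho t \in `]-oo, z[]); last first.
    by apply/seteqP; split=> t /=; rewrite in_itv.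
  exact: mshell.
rewrite measureD; [|exact: mlt|exact: mlt|]; last first.
  by rewrite [X in (X < _)%E](muV y0) ltry.
rewrite setIidr; last by move=> t /=; move/lt_le_trans; exact.
rewrite mulrBr EFinB; congr (_ - _)%E; exact: muV.
Qed.

Let mu_fin (I : interval R) (y : R) : 0 < y -> [set` I] `<=` `]-oo, y[ ->
  (mu [set t | rho t \in I] < +oo)%E.
Proof.
move=> y0 Iy; apply: (@le_lt_trans _ _ (mu [set t | rho t < y])).
  apply: le_measure; rewrite ?inE//.
  - rewrite (_ : [set t | rho t < y] = [set t | rho t \in `]-oo, y[]); last first.
      by apply/seteqP; split=> t /=; rewrite in_itv.
    exact: mshell.
  - by move=> t /= /Iy/=; rewrite in_itv.
by rewrite [X in (X < _)%E](muV y0) ltry.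
Qed.

Let mf : measurable_fun setT f.
Proof. by apply: measurableT_comp => //; exact: continuous_measurable_fun. Qed.

Let intf (I : interval R) (y : R) : 0 < y -> [set` I] `<=` `]-oo, y[ ->
  mu.-integrable [set t | rho t \in I] (EFin \o f).
Proof.
move=> y0 Iy; apply: measurable_bounded_integrable => //.
- exact: mu_fin Iy.
- exact: measurable_funTS.
- exists K; split; first exact: num_real.
  by move=> x Kx t _ /=; apply: (le_trans (QK _)); exact: ltW.
Qed.

Let intc (I : interval R) (y c : R) : 0 < y -> [set` I] `<=` `]-oo, y[ ->
  mu.-integrable [set t | rho t \in I] (EFin \o (fun=> c)).
Proof.
move=> y0 Iy; apply: measurable_bounded_integrable => //.
- exact: mu_fin Iy.
- exists `|c|; split; first exact: num_real.
  by move=> x Kx t _ /=; exact: ltW.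
Qed.

Let F y : R := (\int[mu]_(t in [set t | rho t \in `]R1, y[]) f t)%R.

Let shell_bound (I : interval R) (y c e : R) : 0 < y -> [set` I] `<=` `]-oo, y[ ->
  (forall r, r \in I -> `|Q r - c| <= e) ->
  `|(\int[mu]_(t in [set t | rho t \in I]) f t)%R
     - c * fine (mu [set t | rho t \in I])|
    <= e * fine (mu [set t | rho t \in I]).
Proof.
move=> y0 Iy Qce.
have Qb (r : R) : r \in I -> c - e <= Q r /\ Q r <= c + e.
  by move=> /Qce; rewrite ler_norml; lra.
have mI := mshell I; have iI := intf y0 Iy; have iC z := intc z y0 Iy.
have up := @le_Rintegral _ _ _ mu _ _ _ mI iI (iC (c + e)).
have lo := @le_Rintegral _ _ _ mu _ _ _ mI (iC (c - e)) iI.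
move: up lo; rewrite !Rintegral_cst// mulrDl mulrBl => up lo.
have {}lo := lo (fun t It => proj1 (Qb _ It)).
have {}up := up (fun t It => proj2 (Qb _ It)).
by rewrite ler_norml; lra.
Qed.

Let FB (x y : R) : R1 < x -> x <= y ->
  F y - F x = (\int[mu]_(t in [set t | rho t \in `[x, y[]) f t)%R.
Proof.
move=> R1x xy; have y0 : 0 < y by move: R10; lra.
rewrite /F (_ : [set t | rho t \in `]R1, y[] =
  [set t | rho t \in `]R1, x[] `|` [set t | rho t \in `[x, y[]); last first.
  apply/seteqP; split=> t /=; rewrite !in_itv/=.
    move=> /andP[a b]; have [xt|tx] := leP x (rho t).
      by right; rewrite b.
    by left; rewrite a.
  move=> [/andP[-> /lt_le_trans] ->//|/andP[xt ->]].
  by rewrite (lt_le_trans R1x).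
rewrite Rintegral_setU//; first by rewrite addrAC subrr add0r.
- rewrite (_ : _ `|` _ = [set t | rho t \in `]R1, y[]); last first.
    apply/seteqP; split=> t /=; rewrite !in_itv/=.
      move=> [/andP[-> /lt_le_trans] ->//|/andP[xt ->]].
      by rewrite (lt_le_trans R1x).
    move=> /andP[a b]; have [xt|tx] := leP x (rho t).
      by right; rewrite b.
    by left; rewrite a.
  by apply: (intf y0) => t /=; rewrite !in_itv/= => /andP[].
- apply/disj_setPS => t /= []; rewrite !in_itv/= => /andP[_ tx] /andP[xt _].
  by move: (lt_le_trans tx xt); rewrite ltxx.
Qed.

Let F_increment (x y c e : R) : R1 < x -> x <= y ->
  (forall r, r \in `[x, y[ -> `|Q r - c| <= e) ->
  `|F y - F x - c * (V * (y ^+ N - x ^+ N))| <= e * (V * (y ^+ N - x ^+ N)).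
Proof.
move=> R1x xy Qce; have y0 : 0 < y by move: R10; lra.
rewrite FB//; have := @shell_bound `[x, y[ y c e y0 _ Qce.
rewrite mu_shell//=; last by move: R10; lra.
by apply=> r /=; rewrite !in_itv/= => /andP[].
Qed.

Let F_lip (x y : R) : R1 <= x -> x <= y -> `|F y - F x| <= K * (V * (y ^+ N - x ^+ N)).
Proof.
rewrite le_eqVlt => /predU1P[<-|R1x] xy; last first.
  have := @F_increment x y 0 K R1x xy; rewrite mul0r subr0; apply=> r _.
  by rewrite subr0.
(* For x = R1 the shell lacks its inner sphere, so its measure is only bounded by that of the
   half-open shell; the inequality suffices. *)
have y0 : 0 < y by move: R10; lra.
have -> : F R1 = 0.
  rewrite /F (_ : [set t | _] = set0) ?Rintegral_set0//.
  apply/seteqP; split=> t //=; rewrite in_itv/= => /andP[].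
  by move=> /lt_trans/[apply]; rewrite ltxx.
have I1 : [set` `]R1, y[] `<=` `]-oo, y[.
  by move=> t /=; rewrite !in_itv/= => /andP[].
have := @shell_bound `]R1, y[ y 0 K y0 I1.
rewrite mul0r !subr0 => H; apply: (le_trans (H _)); first by move=> r _; rewrite subr0.
have K0 : 0 <= K by exact: le_trans (normr_ge0 _) (QK 0).
rewrite ler_wpM2l// -lee_fin fineK; last first.
  by rewrite ge0_fin_numE//; exact: mu_fin I1.
rewrite -mu_shell//; apply: le_measure; rewrite ?inE//.
by move=> t /=; rewrite !in_itv/= => /andP[/ltW -> ->].
Qed.

Lemma radial_antiderivative : exists A : R -> R,
  [/\ continuous A, A R1 = 0,
     (A R2)%:E = (\int[mu]_(t in [set t | rho t \in `]R1, R2[]) (f t)%:E)%E &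
     forall r, r \in `]R1, R2[ -> is_derive r 1 A (V * (N%:R * r ^+ N.-1) * Q r)].
Proof.
exists (F \o clamp R1 R2); split.
- move=> r; apply/cvgrPdist_lt => e e0.
  (* A continuous function whose increments dominate those of the integral, up to both ends of
     [R1, R2]. *)
  pose H r : R := K * (V * (clamp R1 R2 r) ^+ N).
  have cN : continuous (fun s => clamp R1 R2 s ^+ N).
    move=> s; apply: (@continuous_comp _ _ _ (clamp R1 R2) (fun y => y ^+ N)).
      exact: clamp_continuous (ltW R12) s.
    exact: exprn_continuous.
  have Hc : continuous H.
    by move=> s; apply: cvgMr; apply: cvgMr; exact: cN.
  have FH x y : x <= y -> `|F (clamp R1 R2 y) - F (clamp R1 R2 x)| <= `|H y - H x|.
    move=> xy; have /andP[c1 c2] := clamp_itv x (ltW R12).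
    apply: (le_trans (F_lip c1 (le_clamp _ _ xy))).
    by apply: le_trans (ler_norm _); rewrite /H mulrBr mulrBr.
  have /cvgrPdist_lt/(_ _ e0) := Hc r; apply: filterS => s; apply: le_lt_trans.
  have [|/ltW] := leP s r; first exact: FH.
  by rewrite distrC [X in _ -> _ <= X]distrC; exact: FH.
- rewrite /= clamp_id ?lexx ?(ltW R12)//.
  apply/eqP; rewrite -normr_le0.
  rewrite /F (_ : [set t | _] = set0) ?Rintegral_set0 ?normr0//.
  apply/seteqP; split=> t //=; rewrite in_itv/= => /andP[].
  by move=> /lt_trans/[apply]; rewrite ltxx.
- rewrite /= clamp_id ?lexx ?(ltW R12)// /F /Rintegral fineK//.
  apply: integrable_fin_num => //; apply: (@intf _ R2); first exact: lt_trans R12.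
  by move=> t /=; rewrite !in_itv/= => /andP[].
- move=> r; rewrite in_itv/= => /andP[r1 r2].
  apply: (@is_derive1_relative _ _ (fun x => V * x ^+ N)).
    exact: (@is_deriveZ _ _ _ _ V r 1 _ (is_derive1_exprn N r)).
  move=> e e0.
  have /cvgrPdist_le/(_ _ e0) := @Qc r; rewrite -nbhs_ballE => -[dl /= dl0 Hd].
  exists (Num.min dl (Num.min (r - R1) (R2 - r))).
    by rewrite !lt_min dl0 !subr_gt0 r1.
  move=> x; rewrite !lt_min !ltr_norml => /and3P[/andP[x1 x2] /andP[x3 x4] /andP[x5 x6]].
  rewrite !clamp_id; [|lra|lra].
  have key y z : R1 < y -> y <= z -> r - dl < y -> z < r + dl ->
      `|F z - F y - (V * z ^+ N - V * y ^+ N) * Q r| <= e * `|V * z ^+ N - V * y ^+ N|.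
    move=> y1 yz yd zd.
    rewrite -mulrBr [X in _ <= _ * X]ger0_norm; last first.
      by rewrite mulr_ge0// subr_ge0 lerXn2r// nnegrE; move: R10; lra.
    rewrite [_ * Q r]mulrC; apply: F_increment => // s; rewrite in_itv/= => /andP[s1 s2].
    rewrite distrC; apply: Hd; rewrite /ball/= ltr_norml; lra.
  have [rx|/ltW xr] := leP r x; first by apply: key; lra.
  rewrite -normrN [X in _ <= _ * X]distrC.
  rewrite (_ : - (_ - _) = F r - F x - (V * r ^+ N - V * x ^+ N) * Q r); last by ring.
  by apply: key; lra.
Qed.

End radial_integral.

(** Reduces directional derivatives to derivatives in one variable, where the chain rule applies. *)
Lemma is_derive_lineP (R : realType) (V : normedModType R) (f : V -> R) (x v : V) (l : R) :
  is_derive x v f l <-> is_derive (0 : R) 1 (fun t => f (t *: v + x)) l.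
Proof.
have E : (fun h => h^-1 *: ((f \o shift x) (h *: v) - f x)) =
    (fun h : R => h^-1 *: (((fun t => f (t *: v + x)) \o shift 0) (h *: 1) -
       f (0 *: v + x))).
  by apply/funext => h /=; rewrite /shift/= addr0 scale0r add0r [h *: 1]mulr1.
split=> -[D <-]; split.
- by move: D; rewrite /derivable E.
- by rewrite /derive E.
- by rewrite /derivable E.
- by rewrite /derive E.
Qed.

(** * Calculus of functions of the Euclidean norm *)

Section radial.
Context (R : realType) (N : nat).
Implicit Types (x : 'rV[R]_N) (i j : 'I_N).

Lemma enorm_sqr x : enorm x ^+ 2 = \sum_i x 0 i ^+ 2.
Proof. by rewrite sqr_sqrtr// sumr_ge0// => i _; exact: sqr_ge0. Qed.

Lemma enormZ (c : R) x : 0 <= c -> enorm (c *: x) = c * enorm x.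
Proof.
move=> c0; rewrite /enorm -[in RHS](ger0_norm c0) -sqrtr_sqr -sqrtrM ?sqr_ge0//.
congr Num.sqrt; rewrite mulr_sumr; apply: eq_bigr => i _.
by rewrite mxE exprMn.
Qed.

Lemma enorm_continuous : continuous (@enorm R N).
Proof.
move=> x; apply: (@continuous_comp _ _ _ (fun y : 'rV[R]_N => \sum_i y 0 i ^+ 2) Num.sqrt).
  apply: (@continuous_big _ _ +%R 0) => [|i _]; first exact: add_continuous.
  move=> y; apply: (@continuous_comp _ _ _ (fun y : 'rV[R]_N => y 0 i) (fun z => z ^+ 2)).
    exact: coord_continuous.
  exact: exprn_continuous.
exact: sqrt_continuous.
Qed.

Lemma is_derive_coord x i j :
  is_derive x (basis_vec R j) (fun y : 'rV[R]_N => y 0 i) (i == j)%:R.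
Proof.
apply/is_derive_lineP.
rewrite (_ : (fun t => _) = (fun t : R => (i == j)%:R * t + x 0 i)); last first.
  by apply/funext => t; rewrite !mxE eqxx/= mulrC.
rewrite -[X in is_derive _ _ _ X]addr0; apply: is_deriveD.
exact: is_derive1_scale.
Qed.

(** On the line through x in direction i the square of the norm is the polynomial |x|^2 + 2 x_i t +
    t^2. *)
Lemma is_derive_enorm x i : 0 < enorm x ->
  is_derive x (basis_vec R i) (@enorm R N) (x 0 i / enorm x).
Proof.
move=> x0; apply/is_derive_lineP.
pose S := enorm x ^+ 2.
have S0 : 0 < S by rewrite exprn_gt0.
pose h (t : R) := S + (2 * x 0 i * t + t * t).
have -> : (fun t => enorm (t *: basis_vec R i + x)) = Num.sqrt \o h.
  apply/funext => t /=; congr Num.sqrt.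
  rewrite /h /S enorm_sqr (bigD1 i)//= [in RHS](bigD1 i)//= !mxE !eqxx/= mulr1.
  rewrite (eq_bigr (fun k => x 0 k ^+ 2)); first by ring.
  by move=> k ki; rewrite !mxE (negbTE ki) mulr0 add0r.
have h0 : h 0 = S by rewrite /h !mulr0 !addr0.
have Dh : is_derive (0 : R) 1 h (2 * x 0 i).
  rewrite -[X in is_derive _ _ _ X]add0r; apply: is_deriveD.
  rewrite -[X in is_derive _ _ _ X]addr0; apply: is_deriveD.
    exact: is_derive1_scale.
  apply: (is_derive_eq (is_deriveM (is_derive_id (0 : R) 1) (is_derive_id (0 : R) 1))).
  by rewrite /GRing.scale/= mul0r addr0.
have Ds : is_derive (h 0) 1 Num.sqrt (2 * enorm x)^-1.
  rewrite h0; apply: (is_derive_eq (is_derive1_sqrt S0)).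
  by rewrite /S sqrtr_sqr ger0_norm// ltW.
apply: (is_derive_eq (is_derive1_comp Ds Dh)).
by field; rewrite gt_eqF.
Qed.

Lemma is_derive_radial (phi : R -> R) (c : R) x i : 0 < enorm x ->
  is_derive (enorm x) 1 phi c ->
  is_derive x (basis_vec R i) (phi \o @enorm R N) (c * (x 0 i / enorm x)).
Proof.
move=> x0 Dphi; apply/is_derive_lineP.
have /is_derive_lineP Dx := is_derive_enorm i x0.
apply: (is_derive1_comp _ Dx).
by rewrite scale0r add0r.
Qed.

Lemma near_eq_continuous (f h : 'rV[R]_N -> R) x :
  (\near x, f x = h x) -> {for x, continuous h} -> {for x, continuous f}.
Proof.
move=> fh hc; rewrite /prop_for /continuous_at (nbhs_singleton fh).
have hf : \near x, h x = f x by near=> y; apply/esym; near: y.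
by apply: cvg_trans hc; exact: near_eq_cvg hf.
Unshelve. all: by end_near. Qed.

Lemma annulus_open (R1 R2 : R) : open (@annulus R N R1 R2).
Proof.
rewrite (_ : annulus R1 R2 = @enorm R N @^-1` `]R1, R2[%classic).
  apply: open_comp; last exact: itv_open.
  by move=> x _; exact: enorm_continuous.
by apply/seteqP; split=> x /=; rewrite in_itv.
Qed.

Lemma closure_annulus (R1 R2 : R) x :
  closure (annulus R1 R2) x -> R1 <= enorm x <= R2.
Proof.
have cl : closed (@enorm R N @^-1` `[R1, R2]%classic).
  apply: closed_comp; last exact: itv_closed.
  by move=> y _; exact: enorm_continuous.
move=> /(closure_subset _) H; have : closure (@enorm R N @^-1` `[R1, R2]%classic) x.
  by apply: H => y /=; rewrite in_itv/= => /andP[? ?]; rewrite !ltW.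
by move/cl; rewrite /= in_itv.
Qed.

Lemma boundary_annulus (R1 R2 : R) x :
  boundary (annulus R1 R2) x -> enorm x = R1 \/ enorm x = R2.
Proof.
move=> [/closure_annulus/andP[]]; rewrite !le_eqVlt.
move=> /predU1P[->|x1]; first by left.
move=> /predU1P[->|x2]; first by right.
case; apply: open_nbhs_nbhs; split; first exact: annulus_open.
by rewrite /annulus/= x1.
Qed.

End radial.

(** * Volume of balls and the radial form of the integral condition *)

Section euclidean_radius.
Context (R : realType) (N : nat).
Implicit Types t : N.-tuple (measurableTypeR R).

Let rho t : R := enorm (row_of_tuple t).

Let rhoE t : rho t = Num.sqrt (\sum_(i < N) tnth t i ^+ 2).
Proof. by congr Num.sqrt; apply: eq_bigr => i _; rewrite mxE. Qed.

Lemma measurable_enorm : measurable_fun setT rho.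
Proof.
rewrite (_ : rho = Num.sqrt \o fun t => \sum_(i < N) tnth t i ^+ 2); last first.
  by apply/funext => t; exact: rhoE.
apply: measurableT_comp.
  by apply: continuous_measurable_fun; exact: sqrt_continuous.
apply: measurable_sum => i; apply: measurable_funX; exact: measurable_tnth.
Qed.

Lemma enorm_tuple_scale (c : R) t : 0 <= c ->
  enorm (row_of_tuple (tuple_scale c t)) = c * enorm (row_of_tuple t).
Proof.
move=> c0; rewrite -enormZ//; congr enorm.
by apply/rowP => i; rewrite !mxE tnth_mktuple.
Qed.

Definition unit_ball_volume : R := fine (lebesgue_tuple R N [set t | rho t < 1]).

Let mlt (r : R) : measurable [set t | rho t < r].
Proof.
rewrite (_ : [set t | _] = rho @^-1` `]-oo, r[%classic); last first.
  by apply/seteqP; split=> t /=; rewrite in_itv.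
by rewrite -[X in measurable X]setTI; exact: measurable_enorm.
Qed.

(** The unit ball lies in the cube [-1, 1]^N, whose measure is a finite product. The volume itself
    is never computed. *)
Let unit_ball_fin : (lebesgue_tuple R N [set t | (rho t < 1)%R] < +oo)%E.
Proof.
pose B (i : 'I_N) : set (measurableTypeR R) := `[(-1)%R, 1%R]%classic.
apply: (@le_lt_trans _ _ (lebesgue_tuple R N [set t | forall i, B i (tnth t i)])).
  apply: le_measure; rewrite ?inE//.
    rewrite (_ : [set t | _] = \bigcap_(i in [set: 'I_N])
        ((@tnth N (measurableTypeR R))^~ i @^-1` B i)).
      apply: fin_bigcap_measurable => // i _; rewrite -[X in measurable X]setTI.
      by apply: measurable_tnth => //; exact: measurable_itv.
    by apply/seteqP; split => [t H i _|t H i]; [exact: H|exact: (H i I)].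
  move=> t /= t1 i; rewrite /B/= in_itv/= -ler_norml.
  apply: le_trans (ltW t1); rewrite rhoE -[leLHS]sqrtr_sqr.
  rewrite ler_sqrt ?sqr_ge0 ?sumr_ge0// => [|*]; last exact: sqr_ge0.
  rewrite (bigD1 i)//= lerDl.
  by apply: sumr_ge0 => *; exact: sqr_ge0.
rewrite lebesgue_tuple_box; last by move=> i; exact: measurable_itv.
rewrite (eq_bigr (fun=> (2%:E)%E)).
  elim/big_rec : _ => [|i x _ xoo]; first exact: ltry.
  by rewrite lte_mul_pinfty// ltry.
by move=> i _; rewrite /B lebesgue_measure_itv/= lte_fin (lt_trans (ltrN10 R) ltr01) -EFinB opprK.
Qed.

Lemma ball_volume (r : R) : 0 < r ->
  lebesgue_tuple R N [set t | rho t < r] = (unit_ball_volume * r ^+ N)%:E.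
Proof.
move=> r0; rewrite -(lebesgue_tuple_scale r0)// mulrC EFinM; congr (_ * _)%E.
rewrite fineK; last by rewrite ge0_fin_numE//; exact: measure_ge0.
congr (lebesgue_tuple R N _).
have E t : (rho (tuple_scale r t) < r) = (rho t < 1).
  by rewrite /rho enorm_tuple_scale ?(ltW r0)// -{2}[r]mulr1 ltr_pM2l.
by apply/seteqP; split=> t /=; rewrite E.
Qed.

(** Condition (ii) in one variable: A is the antiderivative of r^(N-1) Q, and the factor V N divided
    out is the area of the unit sphere. *)
Lemma annulus_antiderivative (q : 'rV[R]_N -> R) (Q : R -> R) (K R1 R2 : R) :
  (0 < N)%N -> 0 < R1 -> R1 < R2 ->
  continuous Q -> (forall r, `|Q r| <= K) ->
  (forall x, annulus R1 R2 x -> q x = Q (enorm x)) ->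
  (lebesgue_integral_rV (annulus R1 R2) q < 0)%E ->
  exists A : R -> R, [/\ continuous A, A R1 = 0, A R2 < 0 &
    forall r, r \in `]R1, R2[ -> is_derive r 1 A (r ^+ N.-1 * Q r)].
Proof.
move=> N0 R10 R12 Qc QK qQ.
have -> : lebesgue_integral_rV (annulus R1 R2) q =
    (\int[lebesgue_tuple R N]_(t in [set t | rho t \in `]R1, R2[]) (Q (rho t))%:E)%E.
  rewrite /lebesgue_integral_rV.
  rewrite (_ : [set t | rho t \in `]R1, R2[] = @row_of_tuple R N @^-1` annulus R1 R2); last first.
    by apply/seteqP; split=> t /=; rewrite in_itv.
  by apply: eq_integral => t; rewrite inE /= => /qQ ->.
move=> int_lt0.
have [A [Ac A1 A2 dA]] := radial_antiderivative measurable_enorm ball_volume R10 R12 Qc QK.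
pose V := unit_ball_volume; have V0 : 0 <= V by rewrite fine_ge0// measure_ge0.
have A2_lt0 : A R2 < 0 by rewrite -lte_fin A2.
(* Positivity of the volume comes from the hypothesis: were V = 0, A would have zero derivative and
   A(R2) = A(R1) = 0. *)
have {V0} V0 : 0 < V.
  rewrite lt_neqAle V0 andbT; apply/negP => /eqP V0'.
  have [||c _] := @MVT R A (fun=> 0) R1 R2 R12.
  - by move=> r /dA; rewrite -/V -V0' !mul0r.
  - exact: continuous_subspaceT.
  by rewrite mul0r A1 subr0 => A20; rewrite A20 ltxx in A2_lt0.
have VN : 0 < (V * N%:R)^-1 by rewrite invr_gt0 mulr_gt0// ltr0n.
exists ((V * N%:R)^-1 \*: A); split.
- by move=> r; apply: cvgZr; exact: Ac.
- by rewrite /= A1 scaler0.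
- by rewrite /= /GRing.scale/= pmulr_rlt0.
- move=> r /dA dAr.
  rewrite (_ : r ^+ _ * _ = (V * N%:R)^-1 *: (V * (N%:R * r ^+ N.-1) * Q r)).
    exact: is_deriveZ.
  rewrite /GRing.scale/=; field.
  by rewrite !gt_eqF// ltr0n.
Qed.
End euclidean_radius.

(** * Radial solutions *)

(** s is the least element of the compact level set; a value >= d before s would, by the
    intermediate value theorem, yield a smaller element. *)
Lemma first_hit (R : realType) (phi : R -> R) (x y d : R) :
  continuous phi -> x <= y -> phi x < d -> d <= phi y ->
  exists s, [/\ x < s, s <= y, phi s = d & forall t, x <= t < s -> phi t < d].
Proof.
move=> phic xy xd dy.
pose S := `[x, y] `&` phi @^-1` [set d].
have ivt z : x <= z -> z <= y -> d <= phi z -> exists2 t, S t & t <= z.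
  move=> xz zy dz.
  have [||t tI td] := @IVT R phi x z d xz.
  - exact: continuous_subspaceT.
  - by rewrite ge_min le_max (ltW xd) dz orbT.
  move: tI; rewrite in_itv/= => /andP[xt tz].
  by exists t => //; split; rewrite //= in_itv/= xt (le_trans tz).
have [t0 St0 _] := ivt y xy (lexx _) dy.
have Sc : compact S.
  apply: (@subclosed_compact _ S `[x, y]) => //; last by move=> ? [].
    apply: closedI; first exact: itv_closed.
    by apply: closed_comp => [z _|]; [exact: phic|exact: closed_eq].
  exact: segment_compact.
have [||s sS smin] := @compact_EVT_min _ R id S _ Sc; first by exists t0.
  by apply: continuous_subspaceT => z; exact: cvg_id.
move: sS; rewrite inE => -[/=]; rewrite in_itv/= => /andP[xs sy] phis.
exists s; split=> //.
  rewrite lt_neqAle xs andbT; apply/negP => /eqP xs'.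
  by move: xd; rewrite xs' phis ltxx.
move=> t /andP[xt ts]; rewrite ltNge; apply/negP => dt.
have [t' St' t't] := ivt t xt (le_trans (ltW ts) sy) dt.
by have := smin t'; rewrite inE => /(_ St') /=; rewrite leNgt (le_lt_trans t't).
Qed.

Section radial_ode.
Context (R : realType) (R1 R2 : R) (p a : R -> R) (pm pM aM : R).
Hypotheses (R12 : R1 < R2) (pm0 : 0 < pm).
Hypothesis p_itv : forall r, pm <= p r <= pM.
Hypothesis a_bnd : forall r, `|a r| <= aM.

(** [p] stands for r^(N-1) and [a] for r^(N-1) Q(r), both continued to the real line with global
    bounds. *)
Definition radial_sol (f : R -> R) := ode_sol R1 R2
  (fun r _ y => y / p r) (fun r x _ => - (a r * f x)).

Let p_gt0 r : 0 < p r.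
Proof. by case/andP: (p_itv r) => + _; exact: lt_le_trans. Qed.

Let pM_gt0 : 0 < pM.
Proof. by case/andP: (p_itv 0) => _; exact: lt_le_trans. Qed.

Let aM_ge0 : 0 <= aM.
Proof. exact: le_trans (normr_ge0 _) (a_bnd 0). Qed.

Section solution.
Variables (f u v : R -> R).
Hypothesis uv : radial_sol f u v.

Lemma radial_mvt x y : R1 <= x -> x < y -> y <= R2 ->
  (exists z, [/\ x < z, z < y & u y - u x = v z / p z * (y - x)]) /\
  (exists z, [/\ x < z, z < y & v y - v x = - (a z * f (u z)) * (y - x)]).
Proof.
move=> x1 xy y2; have [uc vc _ _ D] := uv.
have DI z : z \in `]x, y[ -> z \in `]R1, R2[.
  by rewrite !in_itv/= => /andP[xz zy]; rewrite (le_lt_trans x1 xz) (lt_le_trans zy y2).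
split.
  have [||z zI E] := @MVT R u (fun z => v z / p z) x y xy.
  - by move=> z /DI/D[].
  - exact: continuous_subspaceT.
  by exists z; move: zI; rewrite in_itv/= => /andP[].
have [||z zI E] := @MVT R v (fun z => - (a z * f (u z))) x y xy.
- by move=> z /DI/D[].
- exact: continuous_subspaceT.
by exists z; move: zI; rewrite in_itv/= => /andP[].
Qed.

Lemma u_mvt x y : R1 <= x -> x < y -> y <= R2 ->
  exists z, [/\ x < z, z < y & u y - u x = v z / p z * (y - x)].
Proof. by move=> ? ? ?; have [] := @radial_mvt x y. Qed.

Lemma v_mvt x y : R1 <= x -> x < y -> y <= R2 ->
  exists z, [/\ x < z, z < y & v y - v x = - (a z * f (u z)) * (y - x)].
Proof. by move=> ? ? ?; have [] := @radial_mvt x y. Qed.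

(** Backward Gronwall inequality: E = u^2 + v^2 satisfies E' >= - c E by 2|uv| <= u^2 + v^2, so E
    exp(ct) does not decrease, and E(r) = 0 forces E(R1) = 0. *)
Lemma double_zero (L r : R) : (forall s, `|f s| <= L * `|s|) ->
  R1 <= r <= R2 -> u r = 0 -> v r = 0 -> u R1 = 0.
Proof.
move=> fL /andP[r1 r2] ur vr.
have L0 : 0 <= L by have := le_trans (normr_ge0 _) (fL 1); rewrite normr1 mulr1.
move: r1; rewrite le_eqVlt => /predU1P[->//|r1].
have [uc vc _ _ D] := uv.
pose c := pm^-1 + aM * L.
pose E t := u t * u t + v t * v t.
pose dE t := 2 * u t * (v t / p t) - 2 * v t * (a t * f (u t)).
have E_ge t : - (c * E t) <= dE t.
  have A1 : `|2 * u t * (v t / p t)| <= pm^-1 * E t.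
    rewrite (_ : 2 * u t * (v t / p t) = (p t)^-1 * (2 * (u t * v t))); last by ring.
    rewrite normrM [`|(p t)^-1|]gtr0_norm ?invr_gt0//.
    apply: ler_pM => //; first by rewrite invr_ge0 ltW.
      by rewrite lef_pV2 ?posrE//; case/andP: (p_itv t).
    rewrite normrM ger0_norm// normrM /E -!expr2 -(real_normK (num_real (u t))).
    rewrite -(real_normK (num_real (v t))).
    have := sqr_ge0 (`|u t| - `|v t|); rewrite sqrrB; lra.
  have A2 : `|2 * v t * (a t * f (u t))| <= aM * L * E t.
    rewrite (_ : 2 * v t * (a t * f (u t)) = a t * (2 * (v t * f (u t)))); last by ring.
    rewrite normrM -mulrA; apply: ler_pM => //.
    rewrite !normrM ger0_norm//.
    apply: (@le_trans _ _ (L * (2 * (`|v t| * `|u t|)))).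
      by rewrite [leRHS]mulrCA ler_wpM2l// [leRHS]mulrCA ler_wpM2l.
    rewrite ler_wpM2l// /E -!expr2 -(real_normK (num_real (u t))).
    rewrite -(real_normK (num_real (v t))).
    have := sqr_ge0 (`|u t| - `|v t|); rewrite sqrrB; lra.
  have -> : c * E t = pm^-1 * E t + aM * L * E t by rewrite /c mulrDl.
  by move: A1 A2; rewrite !ler_norml /dE; lra.
have dH t : t \in `]R1, r[ ->
    is_derive t 1 (fun t => E t * expR (c * t)) (expR (c * t) * (dE t + c * E t)).
  rewrite in_itv/= => /andP[t1 tr].
  have [Du Dv] : is_derive t 1 u (v t / p t) /\ is_derive t 1 v (- (a t * f (u t))).
    by apply: D; rewrite in_itv/= t1 (lt_le_trans tr).
  have De : is_derive t 1 (fun t => expR (c * t)) (expR (c * t) * c).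
    apply: (@is_derive1_comp _ expR (fun t => c * t)).
    exact: is_derive1_scale.
  have DE : is_derive t 1 E (dE t).
    apply: (@is_derive_eq _ _ _ _ _ _ _ _ (is_deriveD (is_deriveM Du Du) (is_deriveM Dv Dv))).
    by rewrite /GRing.scale/= /dE; ring.
  apply: (is_derive_eq (is_deriveM DE De)).
  by rewrite /GRing.scale/=; ring.
have [|z zI] := @MVT _ _ _ _ _ r1 dH.
  apply: continuous_subspaceT => t; apply: cvgM.
    by rewrite /E; apply: cvgD; apply: cvgM; [exact: uc|exact: uc|exact: vc|exact: vc].
  apply: (@continuous_comp _ _ _ (fun t => c * t) expR); last exact: continuous_expR.
  by apply: cvgMr; exact: cvg_id.
rewrite {1}/E ur vr !mul0r addr0 mul0r sub0r => H.
have H' : E R1 * expR (c * R1) <= 0.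
  rewrite -oppr_ge0 H mulr_ge0 ?subr_ge0 ?(ltW r1)// mulr_ge0 ?expR_ge0//.
  by have := E_ge z; lra.
move: H'; rewrite pmulr_lle0 ?expR_gt0// /E -!expr2 => H'.
have := sqr_ge0 (u R1); have := sqr_ge0 (v R1) => v2 u2.
by apply/eqP; rewrite -sqrf_eq0; apply/eqP; lra.
Qed.

(* Past its first zero, where v < 0 by uniqueness for the zero data, u stays
   nonpositive, so f (u) = 0 and v is constant. *)
Lemma nonpos_end (L r0 : R) : (forall s, `|f s| <= L * `|s|) ->
  (forall s, s <= 0 -> f s = 0) -> 0 < u R1 ->
  R1 <= r0 <= R2 -> u r0 <= 0 -> v R2 < 0.
Proof.
move=> fL f0 u1 /andP[r1 r2] ur0; have [uc vc _ _ D] := uv.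
have [|||s [s1 sr /eqP us upos]] := @first_hit R (fun r => - u r) R1 r0 0 _ r1.
- by move=> r; apply: cvgN; exact: uc.
- by rewrite oppr_lt0.
- by rewrite oppr_ge0.
move: us; rewrite oppr_eq0 => /eqP us.
have s2 := le_trans sr r2.
have vs : v s < 0.
  rewrite lt_neqAle; apply/andP; split.
    apply/negP => /eqP vs; have := double_zero fL _ us vs.
    by move=> u10; move: u1; rewrite u10 ?ltxx// (ltW s1).
  (* If v(s) > 0, then u increases to 0 just before s, although it is positive there. *)
  rewrite leNgt; apply/negP => vs.
  have /cvgrPdist_lt/(_ _ vs) := vc s; rewrite -nbhs_ballE => -[d /= d0 Hd].
  pose t := Num.max R1 (s - d / 2).
  have ts : t < s by rewrite gt_max s1 ltrBlDr ltrDl divr_gt0.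
  have t1 : R1 <= t by rewrite le_max lexx.
  have [z [tz zs E]] := u_mvt t1 ts s2.
  have vz : 0 < v z.
    have /Hd : ball s d z.
      rewrite /ball/= ltr_norml; have : s - d / 2 <= t by rewrite le_max lexx orbT.
      by move=> ?; lra.
    by rewrite /= ltr_norml => /andP[_]; lra.
  have : 0 < v z / p z * (s - t) by rewrite mulr_gt0 ?divr_gt0 ?subr_gt0.
  by rewrite -E us; have := upos t; rewrite t1 ts => /(_ isT); lra.
(* To reach v(R2) >= 0, v must first return to the level v(s)/2 < 0. Up to that time u <= 0, so v
   cannot have moved from v(s). *)
rewrite ltNge; apply/negP => v2.
have [||s' [ss' s'2 vs' vneg]] := @first_hit R v s R2 (v s / 2) vc s2.
- lra.
- lra.
have uneg t : s <= t -> t <= s' -> u t <= 0.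
  rewrite le_eqVlt => /predU1P[<-|st] ts'; first by rewrite us.
  have [z [sz zt E]] := u_mvt (ltW s1) st (le_trans ts' s'2).
  have vz : v z < v s / 2 by apply: vneg; rewrite (ltW sz) (lt_le_trans zt).
  have : v z / p z * (t - s) <= 0.
    rewrite mulr_le0_ge0 ?subr_ge0 ?(ltW st)// mulr_le0_ge0 ?invr_ge0 ?(ltW (p_gt0 _))//.
    lra.
  by rewrite -E us; lra.
have [z [sz zs' E]] := v_mvt (ltW s1) ss' s'2.
move: E; rewrite f0 ?mulr0 ?oppr0 ?mul0r ?vs'; first lra.
exact: uneg (ltW sz) (ltW zs').
Qed.

(** While u stays in the band around s0, f(u) <= 2 f(s0); hence |v| <= 2 aM f(s0) (R2 - R1), and u
    moves by less than the half-width dl s0: it never leaves the band. There f(u) is within e f(s0)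
    of f(s0), an error too small to change the sign of - f(s0) A(R2). *)
Lemma small_start (A : R -> R) (s0 dl e : R) : continuous A ->
  (forall r, r \in `]R1, R2[ -> is_derive r 1 A (a r)) -> A R1 = 0 ->
  (forall x, `|x - s0| <= dl * s0 -> `|f x - f s0| <= e * f s0) ->
  0 < dl * s0 -> 0 < f s0 -> 0 <= e <= 1 ->
  e * aM * (R2 - R1) < - A R2 ->
  2 * aM * (R2 - R1) ^+ 2 / pm * f s0 < dl * s0 ->
  u R1 = s0 -> v R1 = 0 -> 0 < v R2.
Proof.
move=> Ac dA A1 fe ds0 fs0 /andP[e0 e1] eA fsmall u1 v1.
have [uc vc _ _ D] := uv.
have T0 : 0 < R2 - R1 by rewrite subr_gt0.
have band s : R1 < s -> s <= R2 -> (forall t, R1 <= t < s -> `|u t - s0| < dl * s0) ->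
    `|u s - s0| < dl * s0.
  move=> s1 s2 H.
  have vb t : R1 < t -> t < s -> `|v t| <= 2 * aM * f s0 * (R2 - R1).
    move=> t1 ts; have t2 := ltW (lt_le_trans ts s2).
    have [z [z1 zt E]] := v_mvt (lexx _) t1 t2.
    have fz : `|f (u z)| <= 2 * f s0.
      have /ltW/fe : `|u z - s0| < dl * s0 by apply: H; rewrite (ltW z1) (lt_trans zt).
      move=> h; have : e * f s0 <= f s0 by rewrite ler_piMl// ltW.
      by move: h; rewrite !ler_norml; lra.
    rewrite -[v t]subr0 -v1 E normrM normrN normrM [`|t - R1|]gtr0_norm ?subr_gt0//.
    rewrite (_ : 2 * aM * f s0 * (R2 - R1) = aM * (2 * f s0) * (R2 - R1)); last by ring.
    by rewrite ler_pM ?mulr_ge0// ?subr_ge0 ?(ltW t1)// ?ler_pM// lerB.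
  have [z [z1 zs E]] := u_mvt (lexx _) s1 s2.
  rewrite -[X in `|_ - X|]u1 E normrM normrM [`|s - R1|]gtr0_norm ?subr_gt0//.
  rewrite [`|(p z)^-1|]gtr0_norm ?invr_gt0//.
  apply: (le_lt_trans _ fsmall).
  rewrite (_ : 2 * aM * (R2 - R1) ^+ 2 / pm * f s0 = (2 * aM * f s0 * (R2 - R1)) / pm * (R2 - R1)); last by ring.
  rewrite ler_pM ?mulr_ge0 ?invr_ge0 ?subr_ge0 ?(ltW s1) ?(ltW (p_gt0 _))// ?lerB//.
  rewrite ler_pM ?invr_ge0 ?(ltW (p_gt0 _))// ?vb//.
  by rewrite lef_pV2 ?posrE//; case/andP: (p_itv z).
have ub t : R1 <= t -> t <= R2 -> `|u t - s0| < dl * s0.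
  rewrite le_eqVlt => /predU1P[<-|t1] t2; first by rewrite u1 subrr normr0.
  rewrite ltNge; apply/negP => tb.
  have [||s [s1 st us Hs]] :=
      @first_hit R (fun r => `|u r - s0|) R1 t (dl * s0) _ (ltW t1) _ tb.
  - by move=> r; apply: cvg_norm; apply: cvgB; [exact: uc|exact: cvg_cst].
  - by rewrite u1 subrr normr0.
  by have := band s s1 (le_trans st t2) Hs; rewrite us ltxx.
(* v is compared with - f(s0) A, which it would equal if f(u) were constantly f(s0). *)
have [||z zI] := @MVT R (fun r => v r + f s0 * A r)
    (fun r => - (a r * f (u r)) + f s0 * a r) R1 R2 R12.
- move=> r rI; have [_ Dv] := D r rI.
  apply: is_deriveD; exact: (@is_deriveZ _ _ _ _ (f s0) r 1 _ (dA r rI)).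
- apply: continuous_subspaceT => r; apply: cvgD; first exact: vc.
  by apply: cvgMr; exact: Ac.
move: zI; rewrite in_itv/= => /andP[z1 z2]; rewrite v1 A1 mulr0 addr0 subr0.
rewrite (_ : - (a z * f (u z)) + f s0 * a z = - (a z * (f (u z) - f s0))); last by ring.
have bz : `|a z * (f (u z) - f s0)| <= aM * (e * f s0).
  by rewrite normrM ler_pM// fe// ltW// ub// ltW.
have : aM * (e * f s0) * (R2 - R1) < f s0 * - A R2.
  rewrite (_ : aM * (e * f s0) * (R2 - R1) = f s0 * (e * aM * (R2 - R1))); last by ring.
  by rewrite ltr_pM2l.
have : a z * (f (u z) - f s0) * (R2 - R1) <= aM * (e * f s0) * (R2 - R1).
  by rewrite ler_pM2r//; exact: le_trans (ler_norm _) bz.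
lra.
Qed.

End solution.
End radial_ode.

(** * A priori bounds for nonnegative solutions *)

Section bounds.
Context (R : realType) (R1 R2 : R) (p a : R -> R) (pm pM : R).
Hypothesis pm0 : 0 < pm.
Hypothesis p_itv : forall r, pm <= p r <= pM.

Let p_gt0 r : 0 < p r.
Proof. by case/andP: (p_itv r) => + _; exact: lt_le_trans. Qed.

Let pM_gt0 : 0 < pM.
Proof. by case/andP: (p_itv 0) => _; exact: lt_le_trans. Qed.

Let div_le_of_neg x b r : 0 <= b -> x <= - b -> x / p r <= - (b / pM).
Proof.
move=> b0 xb; rewrite ler_pdivrMr//; apply: (le_trans xb).
rewrite mulNr lerN2 mulrAC ler_pdivrMr// ler_wpM2l//.
by case/andP: (p_itv r).
Qed.

Let div_ge_of_pos x b r : 0 <= b -> b <= x -> b / pM <= x / p r.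
Proof.
move=> b0 bx; rewrite ler_pM ?invr_ge0 ?(ltW pM_gt0)//.
by rewrite lef_pV2 ?posrE//; case/andP: (p_itv r).
Qed.

(* Since v is nonincreasing on [s, t], u is concave up to the weight p, hence
   comparable to its maximum on [x, y]; there v decreases so much that u
   would be negative at s or at t. *)
Lemma sturm_bound (s x y t q0 : R) :
  R1 <= s -> s < x -> x < y -> y < t -> t <= R2 ->
  (forall r, s <= r <= t -> 0 <= a r) ->
  0 < q0 -> (forall r, x <= r <= y -> q0 <= a r) ->
  exists c L, [/\ 0 < c, 0 < L & forall (f u v : R -> R) (M : R), 0 < M ->
    (forall z, 0 <= f z) -> (forall z, c * M <= z -> L * z <= f z) ->
    radial_sol R1 R2 p a f u v ->
    (forall r, s <= r <= t -> 0 <= u r) ->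
    forall r, s <= r <= t -> u r <= M].
Proof.
move=> s1 sx xy yt t2 age0 q00 aq0.
(* The length available on either side of [x, y] for u to fall. *)
pose d := Num.min (x - s) (t - y).
have d0 : 0 < d by rewrite lt_min !subr_gt0 sx.
have dx : d <= x - s by rewrite ge_min lexx.
have dy : d <= t - y by rewrite ge_min lexx orbT.
pose T := t - s; have T0 : 0 < T by rewrite subr_gt0; lra.
(* A drop D from the maximum m to a point r of [x, y] needs |v| >= D pm / T somewhere; by
   monotonicity of v, u then falls by at least D k on the far side of r. As u stays nonnegative,
   u(r) >= k (m - u(r)), that is, u(r) >= c m. *)
pose k := d * pm / (T * pM).
have k0 : 0 < k by rewrite !(divr_gt0, mulr_gt0).
pose c := k / (1 + k).
have k1 : 0 < 1 + k by rewrite addr_gt0.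
have c0 : 0 < c by rewrite divr_gt0.
(* Chosen so that v drops by 2 K m on [x, y], with K = 2 pM / d. Then v(y) <= - K m or v(x) >= K m,
   and u has to change by 2m on a length d, below zero. *)
pose L := 4 * pM / (d * q0 * c * (y - x)).
have yx0 : 0 < y - x by rewrite subr_gt0.
have L0 : 0 < L by rewrite !(divr_gt0, mulr_gt0).
exists c, L; split=> // f u v M M0 fge0 fL uv u0 r1 r1I.
rewrite leNgt; apply/negP => Mr1.
have [uc vc _ _ _] := uv.
have st : s <= t by lra.
have [r0 r0I r0max] := EVT_max st (continuous_subspaceT uc).
move: r0I; rewrite in_itv/= => /andP[sr0 r0t].
have umax r : s <= r <= t -> u r <= u r0 by move=> rI; apply: r0max; rewrite in_itv.
set m := u r0 in r0max umax.
have mM : M < m by exact: lt_le_trans Mr1 (umax _ r1I).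
have m0 : 0 < m by exact: lt_trans mM.
have vdec z w : s <= z -> z <= w -> w <= t -> v w <= v z.
  move=> sz; rewrite le_eqVlt => /predU1P[->//|zw] wt.
  have [e [ze ew E]] := v_mvt uv (le_trans s1 sz) zw (le_trans wt t2).
  have : 0 <= a e * f (u e) * (w - z).
    rewrite mulr_ge0 ?subr_ge0 ?(ltW zw)// mulr_ge0// age0//.
    by rewrite (ltW (le_lt_trans sz ze)) (ltW (lt_le_trans ew wt)).
  by move: E; rewrite mulNr; lra.
have low r : x <= r <= y -> c * m <= u r.
  move=> /andP[xr ry]; pose D := m - u r.
  have D0 : 0 <= D by rewrite subr_ge0 umax//; lra.
  suff Dk : D * k <= u r.
    rewrite /c mulrAC ler_pdivrMr//; have -> : m = D + u r by rewrite subrK.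
    lra.
  have Dpm0 : 0 <= D * pm / T by rewrite divr_ge0 ?mulr_ge0// ltW.
  have kE : D * k = D * pm / T / pM * d.
    by rewrite /k; field; rewrite !gt_eqF.
  have slope w : 0 < w -> w <= T -> D * pm / T * w <= D * pm.
    by move=> w0 wT; rewrite mulrAC ler_pdivrMr// ler_wpM2l// mulr_ge0// ltW.
  have slope' z w g : 0 < w -> w <= T -> g / p z * w = D -> D * pm / T <= g.
    move=> w0 wT gD.
    rewrite -(ler_pM2r w0); apply: (le_trans (slope _ w0 wT)).
    have -> : g * w = D * p z by rewrite -gD mulrAC mulfVK// gt_eqF.
    by rewrite ler_wpM2l//; case/andP: (p_itv z).
  have R1r : R1 <= r by lra.
  have rR2 : r <= R2 by lra.
  have r0R2 : r0 <= R2 by lra.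
  have [r0r|rr0|E] := ltgtP r0 r; last by
    rewrite /D -E subrr mul0r; exact: u0 (introT andP (conj sr0 r0t)).
    have [z [z0 zr E]] := u_mvt uv (le_trans s1 sr0) r0r rR2.
    have rt : r < t by lra.
    have [w [wr wt E']] := u_mvt uv R1r rt t2.
    have vz : D * pm / T <= - v z.
      apply: (@slope' z (r - r0)); [lra|rewrite /T; lra|].
      by rewrite !mulNr -E opprB.
    have vw : v w <= - (D * pm / T) by have := vdec z w; lra.
    have := div_le_of_neg w Dpm0 vw.
    rewrite -(ler_pM2r (_ : 0 < t - r)) ?subr_gt0// -E' => ut.
    have : D * pm / T / pM * d <= D * pm / T / pM * (t - r).
      by apply: ler_wpM2l; [exact: divr_ge0 (ltW pM_gt0)|lra].
    rewrite -kE; have := u0 t; rewrite st lexx => /(_ isT).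
    move: ut; rewrite mulNr; lra.
  have [z [z0 zr E]] := u_mvt uv R1r rr0 r0R2.
  have sr : s < r by lra.
  have [w [wr wt E']] := u_mvt uv s1 sr rR2.
  have vz : D * pm / T <= v z.
    apply: (@slope' z (r0 - r)); [lra|rewrite /T; lra|].
    by rewrite -E.
  have vw : D * pm / T <= v w by have := vdec w z; lra.
  have := div_ge_of_pos w Dpm0 vw.
  rewrite -(ler_pM2r (_ : 0 < r - s)) ?subr_gt0// -E' => ut.
  have : D * pm / T / pM * d <= D * pm / T / pM * (r - s).
    by apply: ler_wpM2l; [exact: divr_ge0 (ltW pM_gt0)|lra].
  rewrite -kE; have := u0 s; rewrite st lexx => /(_ isT).
  lra.
pose K := 2 * pM / d.
have drop : v y - v x <= - (2 * (K * m)).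
  have [z [xz zy ->]] := v_mvt uv (le_trans s1 (ltW sx)) xy (le_trans (ltW yt) t2).
  have uz : c * m <= u z by apply: low; rewrite !ltW.
  have fz : L * (c * m) <= f (u z).
    apply: (@le_trans _ _ (L * u z)); first by rewrite ler_pM2l.
    apply: fL; apply: le_trans uz; rewrite ler_pM2l//; exact: ltW.
  have -> : 2 * (K * m) = q0 * (L * (c * m)) * (y - x).
    rewrite /K /L; field.
    by rewrite !gt_eqF// subr_gt0.
  rewrite mulNr lerN2 ler_wpM2r ?subr_ge0 ?(ltW xy)//.
  have cm0 : 0 < c * m := mulr_gt0 c0 m0.
  have Lcm : 0 <= L * (c * m) := ltW (mulr_gt0 L0 cm0).
  apply: ler_pM => //; first exact: ltW.
  by apply: aq0; rewrite (ltW xz) (ltW zy).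
have Km0 : 0 <= K * m by rewrite mulr_ge0 ?divr_ge0 ?mulr_ge0// ltW.
have KmE : K * m / pM * d = 2 * m by rewrite /K; field; rewrite !gt_eqF.
have Kd w : d <= w -> 2 * m <= K * m / pM * w.
  by move=> dw; rewrite -KmE ler_wpM2l// divr_ge0// ltW.
have [vy|vx] : v y <= - (K * m) \/ K * m <= v x.
  by have [?|?] := leP (K * m) (v x); [right|left; lra].
- have R1y : R1 <= y by lra.
  have [z [yz zt E]] := u_mvt uv R1y yt t2.
  have vz : v z <= - (K * m) by have := vdec y z; lra.
  have := div_le_of_neg z Km0 vz.
  rewrite -(ler_pM2r (_ : 0 < t - y)) ?subr_gt0// -E.
  have := Kd _ dy; have := umax y; have := u0 t; rewrite mulNr lexx st; lra.
- have xR2 : x <= R2 by lra.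
  have [z [sz zx E]] := u_mvt uv s1 sx xR2.
  have vz : K * m <= v z by have := vdec z x; lra.
  have := div_ge_of_pos z Km0 vz.
  rewrite -(ler_pM2r (_ : 0 < x - s)) ?subr_gt0// -E.
  have := Kd _ dx; have := umax x; have := u0 s; rewrite lexx st; lra.
Qed.

(* Between a point where v = 0 and the nearest point of the intervals, a <= 0,
   so u does not decrease on the way. *)
Lemma reach_interval (n : nat) (al be : 'I_n -> R) (f u v : R -> R) (r0 : R) :
  (0 < n)%N -> (forall i, R1 <= al i /\ be i <= R2) -> (forall i, al i <= be i) ->
  (forall r, R1 <= r <= R2 -> (forall i, ~ (al i <= r <= be i)) -> a r <= 0) ->
  (forall z, 0 <= f z) -> radial_sol R1 R2 p a f u v ->
  R1 <= r0 <= R2 -> v r0 = 0 ->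
  exists i r, al i <= r <= be i /\ u r0 <= u r.
Proof.
case: n al be => // n al be _ I12 alb aneg fge0 uv /andP[r01 r02] v0.
(* Clamping r0 to an interval gives its point nearest to r0; for the index of least distance no
   interval meets the open gap in between. *)
pose dist (i : 'I_n.+1) := `|clamp (al i) (be i) r0 - r0|.
have [i _ imin] := @Order.TotalTheory.arg_minP _ _ 'I_n.+1 ord0 xpredT dist isT.
pose k := clamp (al i) (be i) r0.
have kI : al i <= k <= be i by exact: clamp_itv.
have [i1 i2] := I12 i; exists i, k; split=> //.
have [kr0|r0k|E] := ltgtP k r0; last by rewrite E.
- have away r : k < r -> r < r0 -> forall j, ~ (al j <= r <= be j).
    move=> kr rr0 j /andP[jr rj]; have := imin j isT; rewrite /dist -/k.
    rewrite (ltr0_norm (_ : k - r0 < 0)) ?subr_lt0//.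
    case: (clampP r0 (alb j)) => -[h ->]; first lra.
      by rewrite ler0_norm ?subr_le0//; lra.
    by rewrite subrr normr0; lra.
  have vle z : k < z -> z < r0 -> v z <= 0.
    move=> kz zr0.
    have R1z : R1 <= z by lra.
    have [w [zw wr0 E]] := v_mvt uv R1z zr0 r02.
    have : a w * f (u w) * (r0 - z) <= 0.
      rewrite mulr_le0_ge0 ?subr_ge0 ?(ltW zr0)// mulr_le0_ge0//.
      apply: aneg; first lra.
      exact: away (lt_trans kz zw) wr0.
    by move: E; rewrite v0 mulNr; lra.
  have R1k : R1 <= k by lra.
  have [z [kz zr0 E]] := u_mvt uv R1k kr0 r02.
  have : v z / p z * (r0 - k) <= 0.
    rewrite mulr_le0_ge0 ?subr_ge0 ?(ltW kr0)// mulr_le0_ge0 ?vle// invr_ge0 ltW//.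
  by rewrite -E; lra.
- have away r : r0 < r -> r < k -> forall j, ~ (al j <= r <= be j).
    move=> kr rr0 j /andP[jr rj]; have := imin j isT; rewrite /dist -/k.
    rewrite (gtr0_norm (_ : 0 < k - r0)) ?subr_gt0//.
    case: (clampP r0 (alb j)) => -[h ->]; last by rewrite subrr normr0; lra.
      by rewrite ger0_norm ?subr_ge0//; lra.
    lra.
  have vge z : r0 < z -> z < k -> 0 <= v z.
    move=> r0z zk.
    have zR2 : z <= R2 by lra.
    have [w [r0w wz E]] := v_mvt uv r01 r0z zR2.
    have : a w * f (u w) * (z - r0) <= 0.
      rewrite mulr_le0_ge0 ?subr_ge0 ?(ltW r0z)// mulr_le0_ge0//.
      apply: aneg; first lra.
      exact: away r0w (lt_trans wz zk).
    by move: E; rewrite v0 mulNr; lra.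
  have kR2 : k <= R2 by lra.
  have [z [r0z zk E]] := u_mvt uv r01 r0k kR2.
  have : 0 <= v z / p z * (k - r0).
    by rewrite mulr_ge0 ?subr_ge0 ?(ltW r0k)// divr_ge0 ?vge// ltW.
  by rewrite -E; lra.
Qed.

End bounds.

Lemma continuous_comp_clamp (R : realType) (f : R -> R) (x y : R) : x <= y ->
  {within `[x, y], continuous f} -> continuous (f \o clamp x y).
Proof.
move=> xy /subspace_continuousP fc r.
have cI : `[x, y]%classic (clamp x y r) by rewrite /= in_itv/= clamp_itv.
apply: (@cvg_comp _ _ _ (clamp x y) f _ _ _ _ (fc _ cI)) => P wP.
have cc : \forall r' \near r, (fun z => `[x, y]%classic z -> P z) (clamp x y r').
  exact: (clamp_continuous xy wP).
apply: filterS cc => r' /=; apply.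
by rewrite /= in_itv/= clamp_itv.
Qed.

Lemma continuous_bounded (R : realType) (f : R -> R) (x y : R) : x <= y ->
  {within `[x, y], continuous f} -> exists2 K, 0 <= K & forall r, x <= r <= y -> `|f r| <= K.
Proof.
move=> xy fc.
have [|c _ cmax] := @EVT_max R (fun r => `|f r|) x y xy.
  by move=> r; apply: cvg_norm; exact: fc.
by exists `|f c| => // r rI; apply: cmax; rewrite in_itv.
Qed.

(** Near r0 the other intervals are absent, being closed and disjoint from this one, and h > 0; as h
    <= 0 off the union, all points of [R1, R2] near r0 belong to the ith interval. It is therefore
    nondegenerate, wherever in it r0 lies. *)
Lemma positive_subinterval (R : realType) (R1 R2 : R) (h : R -> R)
    (n : nat) (al be : 'I_n -> R) (i : 'I_n) (r0 : R) :
  R1 < R2 -> continuous h -> (forall j, R1 <= al j /\ be j <= R2) ->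
  trivIset [set: 'I_n] (fun j => `[al j, be j]%classic) ->
  (forall r, R1 <= r <= R2 -> (forall j, ~ (al j <= r <= be j)) -> h r <= 0) ->
  al i <= r0 <= be i -> 0 < h r0 ->
  exists x y q, [/\ al i < x, x < y, y < be i, 0 < q & forall r, x <= r <= y -> q <= h r].
Proof.
move=> R12 hc I12 tI hneg r0I h0.
have near_h : \forall r \near r0, 0 < h r.
  by have /cvgr_gt := hc r0; exact.
have near_j : \forall r \near r0, forall j, j != i -> ~ (al j <= r <= be j).
  suff H j : \forall r \near r0, j != i -> ~ (al j <= r <= be j).
    exact: filter_forall H.
  have [ji|ji] := eqVneq j i; first by apply: (@nearW _ (nbhs r0)).
  have : (~` `[al j, be j]%classic) r0.
    move=> r0j; have /trivIsetP/(_ j i I I ji) := tI.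
    by move=> /seteqP[/(_ r0) + _]; apply; split=> //=; rewrite in_itv.
  have oj : open (~` `[al j, be j]%classic) by rewrite openC; exact: itv_closed.
  move=> r0j; have rj : \forall r \near r0, (~` `[al j, be j]%classic) r.
    exact: open_nbhs_nbhs (conj oj r0j).
  by apply: filterS rj => r rj _ rI; apply: rj; rewrite /= in_itv.
have [d /= d0 Hd] : exists2 d, 0 < d & forall r, `|r - r0| < d ->
    0 < h r /\ (forall j, j != i -> ~ (al j <= r <= be j)).
  have nb : \forall r \near r0, 0 < h r /\ (forall j, j != i -> ~ (al j <= r <= be j)).
    exact: filterI near_h near_j.
  have /nbhs_ballP[d /= d0 Hd] := nb.
  by exists d => // r rr0; apply: Hd; rewrite /ball/= distrC.
have inJ r : R1 <= r <= R2 -> `|r - r0| < d -> al i <= r <= be i.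
  move=> rI rd; have [hr Hj] := Hd r rd.
  apply: contrapT => ri; suff : h r <= 0 by rewrite leNgt hr.
  by apply: hneg rI _ => j; have [->|/Hj] := eqVneq j i.
have [I1 I2] := I12 i.
(* The segment lies to the right of r0, or to the left when r0 = R2; its middle third is then
   strictly inside the interval. *)
have [lo [hi [lohi loJ hiJ lod hid]]] : exists lo hi, [/\ lo < hi,
    al i <= lo <= be i, al i <= hi <= be i, r0 - d < lo & hi < r0 + d].
  have [r02|r02] := ltP r0 R2.
    exists r0, (Num.min R2 (r0 + d / 2)); split=> //.
    - by rewrite lt_min r02 ltrDl divr_gt0.
    - have mR : Num.min R2 (r0 + d / 2) <= R2 by rewrite ge_min lexx.
      have md : Num.min R2 (r0 + d / 2) <= r0 + d / 2 by rewrite ge_min lexx orbT.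
      have rm : r0 < Num.min R2 (r0 + d / 2) by rewrite lt_min r02 ltrDl divr_gt0.
      by apply: inJ; rewrite ?ltr_norml; lra.
    - lra.
    - by rewrite gt_min; apply/orP; right; lra.
  exists (Num.max R1 (r0 - d / 2)), r0; split=> //.
  - by rewrite gt_max; apply/andP; split; lra.
  - have mR : R1 <= Num.max R1 (r0 - d / 2) by rewrite le_max lexx.
    have md : r0 - d / 2 <= Num.max R1 (r0 - d / 2) by rewrite le_max lexx orbT.
    have rm : Num.max R1 (r0 - d / 2) < r0 by rewrite gt_max; apply/andP; split; lra.
    by apply: inJ; rewrite ?ltr_norml; lra.
  - by rewrite lt_max; apply/orP; right; lra.
  - lra.
pose x := (2 * lo + hi) / 3; pose y := (lo + 2 * hi) / 3.
have xy : x < y by rewrite /x /y; lra.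
have [q qI qmin] := EVT_min (ltW xy) (continuous_subspaceT hc).
have ax : al i < x by rewrite /x; lra.
have yb : y < be i by rewrite /y; lra.
have hq : 0 < h q.
  move: qI; rewrite in_itv/= /x /y => qI.
  have qd : `|q - r0| < d by rewrite ltr_norml; lra.
  by have [] := Hd q qd.
by exists x, y, (h q); split=> // r rI; apply: qmin; rewrite in_itv.
Qed.

(** * The truncated nonlinearity and the small initial value *)

Section truncation.
Context (R : realType) (g : R -> R) (M : R).
Hypothesis M0 : 0 < M.
Hypothesis gc : {within `[0, +oo[, continuous g}.
Hypothesis g_ge0 : forall s, 0 <= s -> 0 <= g s.
Hypothesis g0 : g 0 = 0.

Definition trunc_ext (s : R) : R := g (clamp 0 M s) * Num.max 1 (s / M).

Lemma trunc_ext_neg s : s <= 0 -> trunc_ext s = 0.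
Proof.
move=> s0; rewrite /trunc_ext.
suff -> : clamp 0 M s = 0 by rewrite g0 mul0r.
by case: (clampP s (ltW M0)) => -[h ->] //; move: M0; lra.
Qed.

Lemma trunc_ext_id s : 0 <= s <= M -> trunc_ext s = g s.
Proof.
move=> sI; rewrite /trunc_ext clamp_id// max_l ?mulr1//.
by case/andP: sI => _; rewrite ler_pdivrMr// mul1r.
Qed.

Lemma trunc_ext_lin s : M <= s -> trunc_ext s = g M * (s / M).
Proof.
move=> Ms; rewrite /trunc_ext max_r; last by rewrite ler_pdivlMr// mul1r.
case: (clampP s (ltW M0)) => -[h ->] //; first by move: M0; lra.
by have -> : s = M by apply/eqP; rewrite eq_le Ms; case/andP: h => _ ->.
Qed.

Lemma trunc_ext_ge0 s : 0 <= trunc_ext s.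
Proof.
rewrite mulr_ge0 ?le_max ?ler01// g_ge0//.
by case/andP: (clamp_itv s (ltW M0)).
Qed.

Let gM : {within `[0, M], continuous g}.
Proof.
apply: continuous_subspaceW gc => s /=; rewrite !in_itv/= andbT.
by case/andP.
Qed.

Lemma trunc_ext_continuous : continuous trunc_ext.
Proof.
move=> s; apply: cvgM; first exact: continuous_comp_clamp (ltW M0) gM s.
apply: (@continuous_max R R (fun=> 1) (fun s => s / M)); first exact: cvg_cst.
by apply: cvgMl; exact: cvg_id.
Qed.

(** g(s) <= s near 0, g(s) <= G <= (G/d) s on [d, M], and beyond M the ratio to s stays that at
    M. *)
Lemma trunc_ext_bound : g s / s @[s --> 0^'+] --> (0 : R) ->
  exists L, forall s, `|trunc_ext s| <= L * `|s|.
Proof.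
move=> gs0.
have [d /= d0 Hd] : exists2 d, 0 < d & forall s, 0 < s -> s < d -> g s <= s.
  have /cvgrPdist_le/(_ _ ltr01) [d /= d0 Hd] := gs0.
  exists d => // s s0 sd; have := Hd s; rewrite /= !sub0r !normrN.
  rewrite (gtr0_norm s0) => /(_ sd s0) /(le_trans (ler_norm _)).
  by rewrite ler_pdivrMr// mul1r.
have [G G0 HG] := continuous_bounded (ltW M0) gM.
pose L := 1 + G / d.
have L0 : 0 <= L by rewrite addr_ge0// divr_ge0// ltW.
have gL s : 0 <= s <= M -> g s <= L * s.
  move=> /andP[]; rewrite le_eqVlt => /predU1P[<-|s0] sM; first by rewrite g0 mulr0.
  have GD : 0 <= G / d * s by rewrite mulr_ge0 ?divr_ge0 ?(ltW s0) ?(ltW d0).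
  rewrite mulrDl mul1r; have [sd|ds] := ltP s d.
    by have := Hd s s0 sd; lra.
  have : g s <= G by apply: (le_trans (ler_norm _)); apply: HG; rewrite ltW.
  have : G <= G / d * s by rewrite mulrAC ler_pdivlMr// ler_wpM2l.
  lra.
exists L => s; rewrite ger0_norm ?trunc_ext_ge0//.
have [s0|/ltW s0] := leP s 0; first by rewrite trunc_ext_neg// mulr_ge0.
rewrite ger0_norm//; have [sM|/ltW Ms] := leP s M.
  by rewrite trunc_ext_id ?s0// gL// s0.
rewrite trunc_ext_lin// mulrA ler_pdivrMr// -mulrA [s * M]mulrC mulrA.
by rewrite ler_wpM2r// gL// lexx ltW.
Qed.

End truncation.

(** c and L are fixed before M: it suffices that M and cM exceed the threshold past which g(s) >= L
    s. *)
Lemma trunc_ext_superlinear (R : realType) (g : R -> R) (c L : R) :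
  g s / s @[s --> +oo] --> +oo -> 0 < c -> 0 < L ->
  \forall M \near +oo, forall z, c * M <= z -> L * z <= trunc_ext g M z.
Proof.
move=> gy c0 L0.
have [S [S0 HS]] : exists S, 0 < S /\ forall s, S <= s -> L * s <= g s.
  have /cvgryPge/(_ L) [S [_ HS]] := gy.
  exists (Num.max 1 (S + 1)); split=> [|s]; first by rewrite lt_max ltr01.
  rewrite ge_max => /andP[s1 sS].
  have s0 : 0 < s by lra.
  by rewrite -ler_pdivlMr//; apply: HS; lra.
near=> M => z cMz.
have SM : S <= M by near: M; apply: nbhs_pinfty_ge; exact: num_real.
have M0 : 0 < M by exact: lt_le_trans SM.
have ScM : S / c <= M by near: M; apply: nbhs_pinfty_ge; exact: num_real.
have Sz : S <= z by apply: le_trans cMz; rewrite mulrC -ler_pdivrMr.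
have [zM|/ltW Mz] := leP z M.
  by rewrite trunc_ext_id ?zM ?HS// andbT (le_trans (ltW S0)).
rewrite trunc_ext_lin// mulrA ler_pdivlMr// mulrAC ler_wpM2r ?HS//.
exact: le_trans (ltW S0) Sz.
Unshelve. all: by end_near. Qed.

(** The order of choice matters: the joint limit fixes the relative width [dl] in terms of e alone,
    and only then is s0 taken small enough for g(s0)/s0 to be below a multiple of [dl]. *)
Lemma small_initial_value (R : realType) (g : R -> R) (e C B : R) :
  regularly_oscillating_at_zero g -> g s / s @[s --> 0^'+] --> (0 : R) ->
  (forall s, 0 < s -> 0 < g s) -> 0 < e -> 0 < C -> 0 < B ->
  exists s0 dl, [/\ 0 < dl * s0, dl * s0 < s0, s0 + dl * s0 <= B,
    forall x, `|x - s0| <= dl * s0 -> `|g x - g s0| <= e * g s0 & C * g s0 < dl * s0].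
Proof.
move=> /cvgrPdist_le osc gs0 gpos e0 C0 B0.
have [[P1 P2] /= [P1n P2n] HP] := osc e e0.
have [d d0 Hd] : exists2 d, 0 < d & forall w, `|w - 1| < d -> P2 w.
  move: P2n => /nbhs_ballP[d /= d0 Hd]; exists d => // w wd.
  by apply: Hd; rewrite /ball/= distrC.
(* The bound d/2 gives the strict inequality required of the ratio x/s0; the bound 1/2 keeps the
   band positive and, with s0 < B/2, below B. *)
pose dl := Num.min (d / 2) (2^-1).
have dl0 : 0 < dl by rewrite lt_min divr_gt0//= invr_gt0.
have dl1 : dl <= 2^-1 by rewrite ge_min lexx orbT.
have dld : dl <= d / 2 by rewrite ge_min lexx.
have small : \forall s \near 0^'+, C * g s < dl * s.
  have dC : 0 < dl / (C + 1) by rewrite divr_gt0 ?addr_gt0.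
  have /cvgrPdist_lt/(_ _ dC) gsm := gs0.
  near=> s.
  have s0 : 0 < s by near: s; exact: nbhs_right_gt.
  have : `|0 - g s / s| < dl / (C + 1) by near: s.
  rewrite sub0r normrN gtr0_norm ?divr_gt0 ?gpos// ltr_pdivrMr//.
  rewrite mulrAC ltr_pdivlMr ?addr_gt0//; apply: le_lt_trans.
  by rewrite mulrC ler_wpM2l ?ltW ?gpos// ltrDl.
have [s0 [[s00 s0B] [s0P s0s]]] :
    exists s, (0 < s /\ s < B / 2) /\ (P1 s /\ C * g s < dl * s).
  apply: (@filter_ex _ (0 : R)^'+).
  near=> s; split; split.
  - by near: s; exact: nbhs_right_gt.
  - by near: s; apply: nbhs_right_lt; rewrite divr_gt0.
  - by near: s.
  - by near: s.
exists s0, dl; split=> //; first exact: mulr_gt0.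
- by rewrite gtr_pMl//; lra.
- by have : dl * s0 <= 2^-1 * s0 by [rewrite ler_pM2r]; lra.
- move=> x xs; have gs : 0 < g s0 by exact: gpos.
  have ws : `|x / s0 - 1| < d.
    rewrite (_ : x / s0 - 1 = (x - s0) / s0); last by field; rewrite gt_eqF.
    rewrite normrM (gtr0_norm (_ : 0 < s0^-1)) ?invr_gt0// ltr_pdivrMr//.
    by apply: (le_lt_trans xs); rewrite ltr_pM2r//; lra.
  have := HP (s0, x / s0) (conj s0P (Hd _ ws)); rewrite /= divfK ?gt_eqF//.
  rewrite (_ : 1 - g x / g s0 = (g s0 - g x) / g s0); last by field; rewrite gt_eqF.
  by rewrite normrM (gtr0_norm (_ : 0 < (g s0)^-1)) ?invr_gt0// ler_pdivrMr// distrC.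
Unshelve. all: by end_near. Qed.

(** * Existence for the radial system *)

Section radial_existence.
Context (R : realType) (R1 R2 : R) (p a : R -> R) (pm pM aM : R).
Hypotheses (R12 : R1 < R2) (pm0 : 0 < pm).
Hypothesis p_itv : forall r, pm <= p r <= pM.
Hypothesis a_bnd : forall r, `|a r| <= aM.
Hypotheses (pc : continuous p) (ac : continuous a).

Let p_gt0 r : 0 < p r.
Proof. by case/andP: (p_itv r) => + _; exact: lt_le_trans. Qed.

Let aM_ge0 : 0 <= aM.
Proof. exact: le_trans (normr_ge0 _) (a_bnd 0). Qed.

Lemma radial_shooting (f : R -> R) (L s0 s1 : R) : continuous f ->
  (forall s, `|f s| <= L * `|s|) -> s0 <= s1 ->
  (forall u v, radial_sol R1 R2 p a f u v -> u R1 = s0 -> v R1 = 0 -> 0 < v R2) ->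
  (forall u v, radial_sol R1 R2 p a f u v -> u R1 = s1 -> v R1 = 0 -> v R2 < 0) ->
  exists u v, [/\ radial_sol R1 R2 p a f u v, s0 <= u R1 <= s1, v R1 = 0 & v R2 = 0].
Proof.
move=> fc fL.
have L0 : 0 <= L by have := le_trans (normr_ge0 _) (fL 1); rewrite normr1 mulr1.
apply: (@shooting _ _ _ _ _ (pm^-1 + aM * L)) => //.
- move=> z; apply: cvgM.
    exact: (@continuous_comp _ _ _ snd snd z (@cvg_snd _ _ _ _ _) (@cvg_snd _ _ _ _ _)).
  apply: cvgV; first by rewrite gt_eqF.
  exact: (@continuous_comp _ _ _ fst p z (@cvg_fst _ _ _ _ _) (@pc z.1)).
- move=> z; apply: cvgN; apply: cvgM.
    exact: (@continuous_comp _ _ _ fst a z (@cvg_fst _ _ _ _ _) (@ac z.1)).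
  apply: (@continuous_comp _ _ _ (fun z => z.2.1) f z _ (@fc z.2.1)).
  exact: (@continuous_comp _ _ _ snd fst z (@cvg_snd _ _ _ _ _) (@cvg_fst _ _ _ _ _)).
- by rewrite addr_ge0 ?invr_ge0 ?mulr_ge0// ltW.
- move=> r x y; rewrite normrM (gtr0_norm (_ : 0 < (p r)^-1)) ?invr_gt0// mulrC.
  apply: ler_pM => //; rewrite ?invr_ge0 ?(ltW (p_gt0 _))// ?lerDr//.
  rewrite ler_wpDr ?mulr_ge0// lef_pV2 ?posrE//; by case/andP: (p_itv r).
- move=> r x y; rewrite normrN normrM.
  apply: (@le_trans _ _ (aM * L * `|x|)).
    by rewrite -mulrA ler_pM.
  by rewrite ler_pM ?mulr_ge0// ?lerDl// ler_wpDl// invr_ge0 ltW.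
Qed.

Variables (n : nat) (al be : 'I_n -> R) (A g : R -> R).
Hypotheses (n0 : (0 < n)%N) (I12 : forall i, R1 <= al i /\ be i <= R2).
Hypothesis tI : trivIset [set: 'I_n] (fun i => `[al i, be i]%classic).
Hypothesis a_ge0 : forall i r, al i <= r <= be i -> 0 <= a r.
Hypothesis a_gt0 : forall i, exists r, al i <= r <= be i /\ 0 < a r.
Hypothesis a_le0 : forall r, R1 <= r <= R2 ->
  (forall i, ~ (al i <= r <= be i)) -> a r <= 0.
Hypotheses (Ac : continuous A) (A1 : A R1 = 0) (A2 : A R2 < 0).
Hypothesis dA : forall r, r \in `]R1, R2[ -> is_derive r 1 A (a r).
Hypothesis gc : {within `[0, +oo[, continuous g}.
Hypothesis g_ge0 : forall s, 0 <= s -> 0 <= g s.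
Hypothesis g_osc : regularly_oscillating_at_zero g.
Hypotheses (g0 : g 0 = 0) (g_gt0 : forall s, 0 < s -> 0 < g s).
Hypothesis g_zero : g s / s @[s --> 0^'+] --> (0 : R).
Hypothesis g_infty : g s / s @[s --> +oo] --> +oo.

Let al_be i : al i <= be i.
Proof. by have [r [/andP[h1 h2] _]] := a_gt0 i; exact: le_trans h2. Qed.

(** Each interval has its own constants, but there are finitely many, so a single large M suits them
    all. A point with v = 0 is first moved into an interval without decreasing u. *)
Let apriori : exists2 M, 0 < M & forall u v, radial_sol R1 R2 p a (trunc_ext g M) u v ->
  (forall r, R1 <= r <= R2 -> 0 < u r) ->
  forall r, R1 <= r <= R2 -> v r = 0 -> u r <= M.
Proof.
have H i : \forall M \near +oo, 0 < M /\ forall u v,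
    radial_sol R1 R2 p a (trunc_ext g M) u v ->
    (forall r, al i <= r <= be i -> 0 <= u r) ->
    forall r, al i <= r <= be i -> u r <= M.
  have [r0 [r0I ar0]] := a_gt0 i.
  have [x [y [q [ax xy yb q0 aq]]]] := positive_subinterval R12 ac I12 tI a_le0 r0I ar0.
  have [i1 i2] := I12 i.
  have [c [L [c0 L0 HcL]]] :=
    sturm_bound pm0 p_itv i1 ax xy yb i2 (@a_ge0 i) q0 aq.
  have sup := trunc_ext_superlinear g_infty c0 L0.
  near=> M; have M0 : 0 < M by near: M; apply: nbhs_pinfty_gt; exact: num_real.
  split=> // u v uv u0; apply: HcL uv u0 => //.
    exact: trunc_ext_ge0.
  by near: M.
have : \forall M \near +oo, forall i, 0 < M /\ forall u v,
    radial_sol R1 R2 p a (trunc_ext g M) u v ->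
    (forall r, al i <= r <= be i -> 0 <= u r) ->
    forall r, al i <= r <= be i -> u r <= M.
  exact: filter_forall H.
move=> /(@filter_ex _ _ _)[M HM].
have M0 : 0 < M by have [] := HM (Ordinal n0).
exists M => // u v uv u0 r rI vr.
have [i [k [kI ruk]]] := reach_interval pm0 p_itv n0 I12 al_be a_le0
  (trunc_ext_ge0 M0 g_ge0) uv rI vr.
have [_ HMi] := HM i; apply: (le_trans ruk); apply: HMi uv _ _ kI => z zI.
apply/ltW/u0; have [i1 i2] := I12 i; case/andP: zI => z1 z2.
by rewrite (le_trans i1 z1) (le_trans z2 i2).
Unshelve. all: by end_near. Qed.

(** The bound M is kept in the conclusion because g is continuous only on the half-line: with 0 < u
    <= M, g can be replaced along u by its composition with [clamp 0 M]. *)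
Lemma radial_existence : exists (u v : R -> R) (M : R),
  [/\ continuous u, continuous v, v R1 = 0 /\ v R2 = 0,
    forall r, 0 < u r <= M &
    forall r, r \in `]R1, R2[ ->
      is_derive r 1 u (v r / p r) /\ is_derive r 1 v (- (a r * g (u r)))].
Proof.
have [M M0 HM] := apriori.
pose f := trunc_ext g M.
have fc : continuous f := trunc_ext_continuous M0 gc.
have [L fL] := trunc_ext_bound M0 gc g_ge0 g0 g_zero.
have fneg : forall s, s <= 0 -> f s = 0 := trunc_ext_neg M0 g0.
have T0 : 0 < R2 - R1 by rewrite subr_gt0.
(* Small enough that the oscillation error e aM (R2 - R1) stays below - A(R2); the added 1 keeps the
   denominator positive. *)
pose e := Num.min 1 (- A R2 / (aM * (R2 - R1) + 1) / 2).
have den0 : 0 < aM * (R2 - R1) + 1 by rewrite ltr_wpDl// mulr_ge0// ltW.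
have e0 : 0 < e by rewrite lt_min ltr01 !divr_gt0// oppr_gt0.
have e1 : e <= 1 by rewrite ge_min lexx.
have eA : e * aM * (R2 - R1) < - A R2.
  have : e <= - A R2 / (aM * (R2 - R1) + 1) / 2 by rewrite ge_min lexx orbT.
  rewrite mulrAC ler_pdivlMr// -mulrA => h.
  have A0 : 0 < - A R2 by rewrite oppr_gt0.
  move: h; rewrite mulrDr mulr1; set z := e * (aM * (R2 - R1)).
  by lra.
pose C := 2 * aM * (R2 - R1) ^+ 2 / pm + 1.
have C0 : 0 < C by rewrite ltr_wpDl// divr_ge0 ?mulr_ge0 ?exprn_ge0 ?(ltW pm0)// ltW.
have [s0 [dl [ds0 dls s0M gosc gsmall]]] :=
  small_initial_value g_osc g_zero g_gt0 e0 C0 M0.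
have s00 : 0 < s0 by exact: lt_trans dls.
have fg x : `|x - s0| <= dl * s0 -> f x = g x.
  by rewrite ler_norml => h; apply: trunc_ext_id; lra.
have fs0 : f s0 = g s0 by apply: fg; rewrite subrr normr0 ltW.
have [|||u [v [uv /andP[su us] v1 v2]]] := @radial_shooting f L s0 (M + 1) fc fL.
- lra.
- move=> u v uv u1 v1.
  apply: (@small_start _ _ _ _ _ _ _ _ R12 pm0 p_itv a_bnd _ _ _ uv A s0 dl e) => //.
  + by move=> x xs; rewrite fs0 fg//; exact: gosc.
  + by rewrite fs0 g_gt0.
  + by rewrite e1 ltW.
  + rewrite fs0; apply: le_lt_trans gsmall.
    by rewrite ler_wpM2r ?(ltW (g_gt0 s00))// /C lerDl.
(* From M + 1 the solution must vanish somewhere: otherwise the a priori bound at R1, where v = 0,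
   would give M + 1 <= M. *)
- move=> u v uv u1 v1.
  have u10 : 0 < u R1 by rewrite u1 addr_gt0.
  apply: contrapT => nv2.
  have upos r : R1 <= r <= R2 -> 0 < u r.
    move=> rI; rewrite ltNge; apply/negP => ur; apply: nv2.
    exact: (nonpos_end pm0 p_itv a_bnd uv fL fneg u10 rI ur).
  have := HM u v uv upos R1; rewrite lexx (ltW R12) => /(_ isT v1).
  by rewrite u1; lra.
have u10 : 0 < u R1 by exact: lt_le_trans su.
have [uc vc ucl vcl D] := uv.
have upos r : R1 <= r <= R2 -> 0 < u r.
  move=> rI; rewrite ltNge; apply/negP => ur.
  have := nonpos_end pm0 p_itv a_bnd uv fL fneg u10 rI ur.
  by rewrite v2 ltxx.
(* The a priori bound is applied at a maximum of u, where v = 0 in every case. *)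
have uM r : R1 <= r <= R2 -> u r <= M.
  have [m mI umax] := EVT_max (ltW R12) (continuous_subspaceT uc).
  move=> rI; apply: (@le_trans _ _ (u m)); first by apply: umax; rewrite in_itv.
  apply: (HM u v uv upos); first by move: mI; rewrite in_itv.
  move: mI; rewrite in_itv/= => /andP[]; rewrite le_eqVlt => /predU1P[<-//|m1].
  rewrite le_eqVlt => /predU1P[->//|m2].
  have mI : m \in `]R1, R2[ by rewrite in_itv/= m1.
  have [Du _] := D m mI.
  have [] := @derive1_at_max R u R1 R2 m (ltW R12) _ mI.
  - by move=> t /D[[]].
  - by move=> t; rewrite in_itv/= => /andP[t1 t2]; apply: umax; rewrite in_itv/= !ltW.
  move=> _; rewrite (@derive_val _ _ _ _ _ _ _ Du) => /eqP.
  by rewrite mulf_eq0 invr_eq0 (gt_eqF (p_gt0 _)) orbF => /eqP.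
exists u, v, M; split=> //.
- by move=> r; rewrite -ucl upos ?uM// clamp_itv// ltW.
- move=> r rI; have [Du Dv] := D r rI; split=> //.
  have rI' : R1 <= r <= R2 by move: rI; rewrite in_itv/= => /andP[? ?]; rewrite !ltW.
  by rewrite -[g (u r)](trunc_ext_id g M0)// (ltW (upos r rI')) uM.
Qed.

End radial_existence.

(** * From the radial equation to the Neumann problem *)

Section radial_solution.
Context (R : realType) (k : nat) (R1 R2 : R) (W v Q F : R -> R).
Let N := k.+1.
Hypotheses (R10 : 0 < R1) (R12 : R1 < R2).
Hypotheses (Wc : continuous W) (vc : continuous v).
Hypotheses (Qc : continuous Q) (Fc : continuous F).
Hypothesis dW : forall r, r \in `]R1, R2[ -> is_derive r 1 W (v r / r ^+ k).
Hypothesis dv : forall r, r \in `]R1, R2[ -> is_derive r 1 v (- (r ^+ k * Q r * F r)).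
Hypotheses (v1 : v R1 = 0) (v2 : v R2 = 0).

Implicit Types (x : 'rV[R]_N) (i j : 'I_N).

Let rho := @enorm R N.
Let u : 'rV[R]_N -> R := W \o rho.
Let Omega := @annulus R N R1 R2.

(* [phi r = W' r / r] and [psi r = phi' r / r], so that the gradient of [u]
   at [x] is [phi (rho x) x] and its Hessian
   [psi (rho x) x_i x_j + phi (rho x) delta_ij]. *)
Let phi (r : R) : R := v r / r ^+ N.
Let psi (r : R) : R := - (Q r * F r) / r ^+ 2 - N%:R * v r / r ^+ N.+2.

Let grad i x : R := phi (rho x) * x 0 i.
Let hess i j x : R := psi (rho x) * x 0 j * x 0 i + phi (rho x) * (i == j)%:R.

Let dphi r : r \in `]R1, R2[ -> is_derive r 1 phi (psi r * r).
Proof.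
move=> rI; have r0 : 0 < r.
  by move: rI R10; rewrite in_itv/= => /andP[r1 _] R1p; exact: lt_trans r1.
have rN : r ^+ N != 0 by rewrite expf_neq0// gt_eqF.
have DI := @is_deriveV R (fun s : R => s ^+ N) r _ 1 rN (is_derive1_exprn N r).
apply: (is_derive_eq (is_deriveM (dv rI) DI)).
rewrite /GRing.scale/= /psi !exprS.
have rk : r ^+ k != 0 by rewrite expf_neq0// gt_eqF.
rewrite /N; field.
by rewrite rk gt_eqF.
Qed.

Let rho_gt0 x : R1 <= rho x -> 0 < rho x.
Proof. exact: lt_le_trans. Qed.

Let OmegaE x : Omega x -> rho x \in `]R1, R2[.
Proof. by rewrite in_itv. Qed.

Let Omega_gt0 x : Omega x -> 0 < rho x.
Proof. by case/andP=> /ltW/rho_gt0. Qed.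

Let Omega_near x : Omega x -> \near x, Omega x.
Proof. by move=> Ox; apply: open_nbhs_nbhs; split=> //; exact: annulus_open. Qed.

Let du i x : Omega x -> is_derive x (basis_vec R i) u (grad i x).
Proof.
move=> Ox; apply: (is_derive_eq (is_derive_radial i (Omega_gt0 Ox) (dW (OmegaE Ox)))).
rewrite /grad /phi /N exprS -/(rho x); field.
by rewrite expf_neq0 gt_eqF// Omega_gt0.
Qed.

Let partial_u i x : Omega x -> partial i u x = grad i x.
Proof. by move=> Ox; exact: (@derive_val _ _ _ _ _ _ _ (du i Ox)). Qed.

Let dgrad i j x : Omega x -> is_derive x (basis_vec R j) (grad i) (hess i j x).
Proof.
move=> Ox; have D1 := is_derive_radial j (Omega_gt0 Ox) (dphi (OmegaE Ox)).
apply: (is_derive_eq (is_deriveM D1 (is_derive_coord x i j))).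
rewrite /GRing.scale/= /hess -/(rho x); field.
by rewrite gt_eqF// Omega_gt0.
Qed.

Let dpartial_u i j x : Omega x -> is_derive x (basis_vec R j) (partial i u) (hess i j x).
Proof.
move=> Ox; apply: (near_eq_is_derive _ (dgrad i j Ox)).
by apply: filterS (Omega_near Ox) => y /(partial_u i) ->.
Qed.

Let hessE i j x : Omega x -> partial j (partial i u) x = hess i j x.
Proof. by move=> Ox; exact: (@derive_val _ _ _ _ _ _ _ (dpartial_u i j Ox)). Qed.

Let cont_quot (f : R -> R) n x : continuous f -> 0 < rho x ->
  {for x, continuous (fun y => f (rho y) / rho y ^+ n)}.
Proof.
move=> fc x0.
have fx := @continuous_comp _ _ _ rho f x (@enorm_continuous R N x) (@fc (rho x)).
have rx := @continuous_comp _ _ _ rho (fun z => z ^+ n) x (@enorm_continuous R N x)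
  (@exprn_continuous R n (rho x)).
have nz : rho x ^+ n != 0 by rewrite expf_neq0// gt_eqF.
exact: (cvgM fx (cvgV nz rx)).
Qed.

Let cont_coord i x : {for x, continuous (fun y : 'rV[R]_N => y 0 i)}.
Proof. exact: coord_continuous. Qed.

Let grad_continuous i x : 0 < rho x -> {for x, continuous (grad i)}.
Proof.
by move=> x0; exact: (continuousM (@cont_quot v N x vc x0) (@cont_coord i x)).
Qed.

Let hess_continuous i j x : 0 < rho x -> {for x, continuous (hess i j)}.
Proof.
move=> x0.
have QFc : continuous (fun r => - (Q r * F r)).
  by move=> r; apply: cvgN; apply: cvgM; [exact: Qc|exact: Fc].
have Nvc : continuous (fun r => N%:R * v r) by move=> r; apply: cvgMr; exact: vc.
have psic := continuousB (@cont_quot _ 2 x QFc x0) (@cont_quot _ N.+2 x Nvc x0).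
have := continuousD
  (continuousM (continuousM psic (@cont_coord j x)) (@cont_coord i x))
  (continuousM (@cont_quot v N x vc x0) (@cst_continuous _ R ((i == j)%:R : R) x)).
exact.
Qed.

Let u_continuous : continuous u.
Proof.
by move=> x; exact: (@continuous_comp _ _ _ rho W x (@enorm_continuous R N x) (@Wc (rho x))).
Qed.

(** W has a known derivative only inside the interval; the mean value theorem and v(c) = 0 give W(c)
    - W(r) = o(|r - c|) at the ends. *)
Let one_sided c e : c = R1 \/ c = R2 -> 0 < e -> exists2 d, 0 < d &
  forall r, R1 < r -> r < R2 -> `|r - c| < d -> `|W c - W r| <= e * `|r - c|.
Proof.
move=> cR e0; have vc0 : v c = 0 by case: cR => ->.
have e1 : 0 < e * R1 ^+ k by rewrite mulr_gt0// exprn_gt0.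
have /cvgrPdist_lt/(_ _ e1) := @vc c; rewrite vc0 -nbhs_ballE => -[d /= d0 Hd].
exists d => // r r1 r2 rc.
have bound z : R1 < z -> z < R2 -> `|z - c| < d -> `|v z / z ^+ k| <= e.
  move=> z1 z2 zc; have z0 : 0 < z by exact: lt_trans z1.
  rewrite normrM normfV (gtr0_norm (exprn_gt0 _ z0)) ler_pdivrMr ?exprn_gt0//.
  have /ltW : `|0 - v z| < e * R1 ^+ k by apply: Hd; rewrite /ball/= distrC.
  rewrite sub0r normrN => /le_trans; apply; rewrite ler_pM2l//.
  by rewrite lerXn2r ?nnegrE ?ltW.
have mvt (y z : R) : R1 <= y -> y < z -> z <= R2 ->
    exists s, [/\ y < s, s < z & W z - W y = v s / s ^+ k * (z - y)].
  move=> y1 yz z2.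
  have DW s : s \in `]y, z[ -> is_derive s 1 W (v s / s ^+ k).
    rewrite in_itv/= => /andP[ys sz]; apply: dW.
    by rewrite in_itv/= (le_lt_trans y1 ys) (lt_le_trans sz z2).
  have [s sI E] := MVT yz DW (continuous_subspaceT Wc).
  by exists s; move: sI; rewrite in_itv/= => /andP[].
case: cR => ?; subst c.
- have [z [z1 zr E]] := mvt R1 r (lexx _) r1 (ltW r2).
  rewrite distrC E normrM ler_wpM2r// bound//; first exact: lt_trans r2.
  by move: rc; rewrite !gtr0_norm ?subr_gt0//; lra.
- have [z [zr z2 E]] := mvt r R2 (ltW r1) r2 (lexx _).
  rewrite E normrM [`|r - R2|]distrC ler_wpM2r// bound//; first exact: lt_trans zr.
  by move: rc; rewrite !ltr0_norm ?subr_lt0//; lra.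
Qed.

(** A step t along the inward normal changes the radius by exactly t and stays in the annulus for
    small t, so the quotient is the one of W at the endpoint. *)
Let normal_derivative x : boundary Omega x ->
  is_normal_derivative u x (annulus_normal R1 x) 0.
Proof.
move=> /boundary_annulus cR; have x0 : 0 < rho x.
  by case: cR; rewrite -/(rho x) => ->//; exact: lt_trans R12.
have dist : \forall t \near (0 : R)^'+, [/\ R1 < rho (x - t *: annulus_normal R1 x),
    rho (x - t *: annulus_normal R1 x) < R2 &
    `|rho (x - t *: annulus_normal R1 x) - rho x| = t].
  near=> t.
  have t0 : 0 < t by near: t; exact: nbhs_right_gt.
  have tT : t < R2 - R1 by near: t; apply: nbhs_right_lt; rewrite subr_gt0.
  have tR : t < R1 by near: t; exact: nbhs_right_lt.
  rewrite /annulus_normal -/(rho x); case: eqP => [x1|xn1].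
    rewrite (_ : x - _ = (1 + t / rho x) *: x); last first.
      by rewrite scalerA mulrN scaleNr opprK scalerDl scale1r.
    rewrite /rho enormZ -/rho; last by rewrite addr_ge0 ?divr_ge0 ?ltW.
    rewrite -/(rho x) mulrDl mul1r divfK ?gt_eqF// addrAC subrr add0r x1.
    by rewrite gtr0_norm//; split=> //; lra.
  have {cR xn1} x2 : rho x = R2 by case: cR.
  rewrite (_ : x - _ = (1 - t / rho x) *: x); last first.
    by rewrite scalerA scalerBl scale1r.
  rewrite /rho enormZ -/rho; last first.
    by rewrite subr_ge0 ler_pdivrMr// mul1r x2; lra.
  rewrite -/(rho x) mulrBl mul1r divfK ?gt_eqF// addrAC subrr add0r x2.
  by rewrite normrN gtr0_norm//; split=> //; lra.
apply/cvgrPdist_le => e e0; have [d d0 Hd] := one_sided cR e0.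
near=> t; rewrite sub0r normrN.
have t0 : 0 < t by near: t; exact: nbhs_right_gt.
have [r1 r2 rt] : [/\ R1 < rho (x - t *: annulus_normal R1 x),
    rho (x - t *: annulus_normal R1 x) < R2 &
    `|rho (x - t *: annulus_normal R1 x) - rho x| = t] by near: t.
rewrite normrM normfV (gtr0_norm t0) ler_pdivrMr//.
have := Hd _ r1 r2; rewrite rt; apply.
by near: t; exact: nbhs_right_lt.
Unshelve. all: by end_near. Qed.

Lemma radial_neumann_solution (q : 'rV[R]_N -> R) (g : R -> R) :
  (forall x, Omega x -> q x = Q (rho x)) ->
  (forall r, F r = g (W r)) -> classical_neumann_solution R1 R2 q g u.
Proof.
move=> qQ Fg; split.
- split=> [x _|i x Ox|i j x Ox]; first exact: u_continuous.
  + have [? _] := du i Ox; split=> //.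
    have nE : \near x, partial i u x = grad i x.
      by apply: filterS (Omega_near Ox) => y; exact: partial_u.
    exact: near_eq_continuous nE (@grad_continuous i x (Omega_gt0 Ox)).
  + have [? _] := dpartial_u i j Ox; split=> //.
    have nE : \near x, partial j (partial i u) x = hess i j x.
      by apply: filterS (Omega_near Ox) => y; exact: hessE.
    exact: near_eq_continuous nE (@hess_continuous i j x (Omega_gt0 Ox)).
- split; first exact: continuous_subspaceT.
  move=> i; split; first by move=> x /(du i)[].
  (* The explicit gradient is continuous wherever |x| > 0, hence up to the boundary. *)
  exists (grad i); last by move=> x /(partial_u i).
  apply: continuous_in_subspaceT => x; rewrite inE => /closure_annulus/andP[x1 _].
  exact: grad_continuous (rho_gt0 x1).
(* The trace of the Hessian is psi r^2 + N phi, and the term - N v / r^N in psi r^2 cancels N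
   phi. *)
- move=> x Ox; rewrite /laplacian.
  under eq_bigr do rewrite hessE//.
  rewrite big_split/= -[\sum_(i < N) (phi _ * _)]mulr_sumr.
  under eq_bigr do rewrite -mulrA -expr2.
  rewrite -mulr_sumr -enorm_sqr -/(rho x).
  under [\sum_(i < N) (_ == _)%:R]eq_bigr do rewrite eqxx.
  rewrite sumr_const card_ord qQ// -Fg /psi /phi.
  have r0 := Omega_gt0 Ox.
  have rk : rho x ^+ k != 0 by rewrite expf_neq0// gt_eqF.
  rewrite (_ : (true%:R : R) = 1)// /N !exprS; field.
  by rewrite rk gt_eqF.
- exact: normal_derivative.
Qed.

End radial_solution.

Theorem theorem4p1 (R : realType) (N : nat) (R1 R2 : R)
    (g : R -> R) (q : 'rV[R]_N -> R) (Q : R -> R)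
    (m : nat) (a b : 'I_m -> R) :
  (2 <= N)%N ->
  0 < R1 -> R1 < R2 ->
  {within `[0, +oo[, continuous g} ->
  (forall s, 0 <= s -> 0 <= g s) ->
  regularly_oscillating_at_zero g ->
  g 0 = 0 ->
  (forall s, 0 < s -> 0 < g s) ->
  g s / s @[s --> 0^'+] --> (0 : R) ->
  g s / s @[s --> +oo] --> +oo ->
  {within closure (annulus R1 R2), continuous q} ->
  {within `[R1, R2], continuous Q} ->
  (forall x, closure (annulus R1 R2) x -> q x = Q (enorm x)) ->
  (1 <= m)%N ->
  (forall i, `[a i, b i] `<=` `[R1, R2]) ->
  trivIset [set: 'I_m] (fun i => `[a i, b i]%classic) ->
  (forall i r, r \in `[a i, b i] -> 0 <= Q r) ->
  (forall i, exists r, [/\ r \in `[a i, b i],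
     forall r', r' \in `[a i, b i] -> Q r' <= Q r & 0 < Q r]) ->
  (forall r, r \in `[R1, R2] -> (forall i, r \notin `[a i, b i]) ->
     Q r <= 0) ->
  (lebesgue_integral_rV (annulus R1 R2) q < 0)%E ->
  exists u : 'rV[R]_N -> R,
    [/\ classical_neumann_solution R1 R2 q g u,
        forall x, annulus R1 R2 x -> 0 < u x &
        radially_symmetric (closure (annulus R1 R2)) u].
Proof.
case: N q => // k q _ R10 R12 gc gge0 osc g0 gpos gz ginf _ Qc qQ m0 Jsub tI
  Qge0 Qmax Qle0 int_lt0.
have R12' := ltW R12.
pose Qt := Q \o clamp R1 R2.
have Qtc : continuous Qt := continuous_comp_clamp R12' Qc.
have QtE r : R1 <= r <= R2 -> Qt r = Q r by move=> rI; rewrite /Qt/= clamp_id.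
have [K K0 QK] := continuous_bounded R12' Qc.
have QtK r : `|Qt r| <= K by apply: QK; exact: clamp_itv.
have qQt x : annulus R1 R2 x -> q x = Qt (enorm x).
  move=> Ox; rewrite qQ; last exact: subset_closure.
  by rewrite QtE//; case/andP: Ox => ? ?; rewrite !ltW.
have [A [Ac A1 A2 dA]] := annulus_antiderivative (ltn0Sn k) R10 R12 Qtc QtK qQt int_lt0.
(* With N = k + 1 the weight r^(N-1) is r^k; clamping r first keeps it between R1^k and R2^k on the
   whole line. *)
pose p (r : R) := clamp R1 R2 r ^+ k.
pose w r := p r * Qt r.
have pE r : R1 <= r <= R2 -> p r = r ^+ k by move=> rI; rewrite /p clamp_id.
have R20 := lt_trans R10 R12.
have p_itv r : R1 ^+ k <= p r <= R2 ^+ k.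
  have /andP[c1 c2] := clamp_itv r R12'.
  have c0 := lt_le_trans R10 c1.
  by rewrite !lerXn2r ?nnegrE ?(ltW R10) ?(ltW c0) ?(ltW R20) ?c1.
have R1k : 0 < R1 ^+ k by rewrite exprn_gt0.
have p_gt0 r : 0 < p r by case/andP: (p_itv r) => + _; exact: lt_le_trans.
have pc : continuous p.
  move=> r; exact: (@continuous_comp _ _ _ (clamp R1 R2) (fun z => z ^+ k) r
    (@clamp_continuous R R1 R2 R12' r) (@exprn_continuous R k _)).
have wc : continuous w by move=> r; apply: cvgM; [exact: pc|exact: Qtc].
have w_bnd r : `|w r| <= R2 ^+ k * K.
  rewrite normrM ler_pM// gtr0_norm//.
  by case/andP: (p_itv r).
have ab i : a i <= b i.
  by have [r [+ _ _]] := Qmax i; rewrite in_itv/= => /andP[]; exact: le_trans.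
have I12 i : R1 <= a i /\ b i <= R2.
  have := Jsub i (a i); have := Jsub i (b i).
  rewrite /= !in_itv/= !lexx ab/= => /(_ isT)/andP[_ ?] /(_ isT)/andP[? _].
  by split.
have inR i r : a i <= r <= b i -> R1 <= r <= R2.
  by have [i1 i2] := I12 i; move=> /andP[ar rb]; rewrite (le_trans i1)//= (le_trans rb).
have w_ge0 i r : a i <= r <= b i -> 0 <= w r.
  move=> rI; rewrite mulr_ge0 ?(ltW (p_gt0 r))// QtE ?(inR i)//.
  by apply: (Qge0 i); rewrite in_itv.
have w_gt0 i : exists r, a i <= r <= b i /\ 0 < w r.
  have [r [+ _ Qr]] := Qmax i; rewrite in_itv/= => rI; exists r; split=> //.
  by rewrite mulr_gt0// QtE// (inR i).
have w_le0 r : R1 <= r <= R2 -> (forall i, ~ (a i <= r <= b i)) -> w r <= 0.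
  move=> rI nJ; rewrite pmulr_rle0// QtE//; apply: Qle0; first by rewrite in_itv.
  by move=> i; apply/negP; rewrite in_itv; exact: nJ.
have dA' r : r \in `]R1, R2[ -> is_derive r 1 A (w r).
  move=> rI; rewrite /w pE; first exact: dA.
  by move: rI; rewrite in_itv/= => /andP[? ?]; rewrite !ltW.
have [u [v [M [uc vc [v1 v2] uM D]]]] := radial_existence R12 R1k p_itv w_bnd pc wc
  m0 I12 tI w_ge0 w_gt0 w_le0 Ac A1 A2 dA' gc gge0 osc g0 gpos gz ginf.
have M0 : 0 <= M by have /andP[/ltW + ] := uM 0; exact: le_trans.
have gMc : continuous (g \o clamp 0 M).
  apply: continuous_comp_clamp M0 (continuous_subspaceW _ gc) => s /=.
  by rewrite !in_itv/= andbT => /andP[].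
have guE : g \o u = (g \o clamp 0 M) \o u.
  by apply/funext => r /=; rewrite clamp_id//; have /andP[/ltW -> ->] := uM r.
have guc : continuous (g \o u).
  rewrite guE => r; exact: (@continuous_comp _ _ _ u _ r (@uc r) (@gMc (u r))).
have rI' r : r \in `]R1, R2[ -> R1 <= r <= R2.
  by rewrite in_itv/= => /andP[? ?]; rewrite !ltW.
exists (u \o @enorm R k.+1); split.
- apply: (radial_neumann_solution R10 R12 uc vc Qtc guc _ _ v1 v2) => //.
  + by move=> r rI; have [+ _] := D r rI; rewrite pE ?rI'.
  + by move=> r rI; have [_] := D r rI; rewrite /w pE ?rI'.
- by move=> x _; have /andP[] := uM (enorm x).
- by move=> x y _ _ /= ->.
Qed.
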